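(* Let $\mathcal K$ be a 3-dimensional simplicial complex embedded in $\mathbb R^3$ triangulating a closed bounded domain $\Omega$ with Lipschitz boundary that is homeomorphic to a closed 3-ball. Then $\mathcal K$ is collapsible if and only if there exists a complete acyclic matching of 1-chains on the canonical basis of $\mathcal K$.
   Context: Cells (simplices) of $\mathcal K$ are oriented; $\mathcal K_j$ is the set of $j$-simplices. The canonical basis of the chain complex consists of the simplices themselves. For an edge $e$ and a triangle $f$, write $e\prec f$ iff $e\subset\partial f$ (equivalently the face–edge incidence number is nonzero). A matching of 1-chains on the canonical basis is a set $\mathcal M_1$ of pairs $(e,f)$ with $e$ an edge, $f$ a triangle, $e\prec f$, such that every edge and every triangle belongs to at most one pair. It is acyclic if there is no cycle $f_1\succ e_1\prec f_2\succ\cdots\prec f_h\succ e_h\prec f_1$ with $h\ge2$, all $(e_i,f_i)\in\mathcal M_1$ and the $f_i$ distinct. It is complete if its number of pairs equals the rank of the face–edge incidence matrix $\mathbf C$ (entries $\pm1$ if $e\subset\partial f$ with sign given by orientation, $0$ otherwise). An elementary collapse removes from a complex a pair $(\sigma,\tau)$ of cells with $\sigma\subset\tau$, $\dim\sigma=\dim\tau-1$, such that $\tau$ is the only cell of the complex properly containing $\sigma$ (and hence $\tau$ is maximal). $\mathcal K$ is collapsible if a finite sequence of elementary collapses reduces it to a single vertex. *)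

(* Defs.v *)
From HB Require Import structures.
From mathcomp Require Import all_boot all_order all_algebra.
From mathcomp Require Import all_classical all_reals all_analysis.
Set Implicit Arguments. Unset Strict Implicit. Unset Printing Implicit Defensive.
Import Order.TTheory GRing.Theory Num.Theory.
Import numFieldNormedType.Exports.
Local Open Scope ring_scope.

Section Defs.
Variable V : finType.

Definition is_simplicial_complex (K : {set {set V}}) : Prop :=
  (@finset.set0 V) \notin K /\
  forall s t : {set V}, s \in K -> t \subset s -> t != @finset.set0 V -> t \in K.

Definition complex_dim (K : {set {set V}}) (d : nat) : Prop :=
  (exists s, s \in K /\ #|s| = d.+1) /\ (forall s, s \in K -> #|s| <= d.+1)%N.

Definition simplices (K : {set {set V}}) (j : nat) : {set {set V}} :=
  [set s in K | #|s| == j.+1].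

Definition elementary_collapse (K K' : {set {set V}}) : Prop :=
  exists s t : {set V},
    [/\ s \in K /\ t \in K, s \proper t, #|t| = #|s|.+1,
        (forall u, u \in K -> s \proper u -> u = t) &
        K' = (K :\ s) :\ t].

Inductive collapses_to (K : {set {set V}}) : {set {set V}} -> Prop :=
| collapses_refl : collapses_to K K
| collapses_step K1 K2 : collapses_to K K1 -> elementary_collapse K1 K2 ->
    collapses_to K K2.

Definition collapsible (K : {set {set V}}) : Prop :=
  exists v : V, collapses_to K [set [set v]].

(** Orientation and face-edge incidence. The orientation of every simplex is
    given relative to the reference orientation induced by the vertex order
    (enum_rank) of V: [or s = true] means the opposite orientation.
    For a triangle f = [v0 < v1 < v2] and an edge e = f minus v_i, the reference
    incidence is (-1)^i. *)
Definition ref_incidence_exp (e f : {set V}) : nat :=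
  (\sum_(v in f :\: e) #|[set u in f | enum_rank u < enum_rank v]|)%N.

Definition incidence (R : nzRingType) (or : {set V} -> bool) (e f : {set V}) : R :=
  if e \subset f then (-1) ^+ (or e + or f + ref_incidence_exp e f)%N else 0.

Definition face_edge_matrix (R : nzRingType) (K : {set {set V}}) (or : {set V} -> bool) :
  'M[R]_(#|simplices K 2|, #|simplices K 1|) :=
  \matrix_(i < #|simplices K 2|, j < #|simplices K 1|)
     incidence R or (enum_val j) (enum_val i).

Definition matching1 (K : {set {set V}}) (M : {set {set V} * {set V}}) : Prop :=
  [/\ (forall p, p \in M ->
         [/\ p.1 \in simplices K 1, p.2 \in simplices K 2 & p.1 \subset p.2]),
      (forall p q, p \in M -> q \in M -> p.1 = q.1 -> p = q) &
      (forall p q, p \in M -> q \in M -> p.2 = q.2 -> p = q)].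

(** Acyclic: no cycle f_1 > e_1 < f_2 > ... < f_h > e_h < f_1 with h >= 2,
    (e_i, f_i) in M and the f_i distinct.  The cycle is the sequence of pairs
    (e_i, f_i); the condition e_i < f_{i+1} is taken cyclically. *)
Definition acyclic1 (M : {set {set V} * {set V}}) : Prop :=
  ~ exists c : seq ({set V} * {set V}),
      [/\ (2 <= size c)%N, all (fun p => p \in M) c, uniq (map snd c) &
          forall i, (i < size c)%N ->
            (nth (@finset.set0 V, @finset.set0 V) c i).1 \subset (nth (@finset.set0 V, @finset.set0 V) c (i.+1 %% size c)).2].

Definition complete1 (R : fieldType) (K : {set {set V}}) (or : {set V} -> bool)
  (M : {set {set V} * {set V}}) : Prop :=
  #|M| = \rank (face_edge_matrix R K or).

End Defs.

Section GeomK.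
Local Open Scope classical_set_scope.
Variable V : finType.
Variable R : realType.

Definition conv_hull (pos : V -> 'rV[R]_3) (s : {set V}) : set 'rV[R]_3 :=
  [set x | exists w : V -> R,
     [/\ forall v, 0 <= w v, forall v, v \notin s -> w v = 0,
         \sum_v w v = 1 & x = \sum_v w v *: pos v]].

Definition aff_indep (pos : V -> 'rV[R]_3) (s : {set V}) : Prop :=
  forall w : V -> R, (forall v, v \notin s -> w v = 0) ->
    \sum_v w v = 0 -> \sum_v w v *: pos v = 0 -> forall v, w v = 0.

Definition geometric_realization (pos : V -> 'rV[R]_3) (K : {set {set V}}) : Prop :=
  (forall s, s \in K -> aff_indep pos s) /\
  (forall s t, s \in K -> t \in K ->
     conv_hull pos s `&` conv_hull pos t = conv_hull pos (s :&: t)).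

Definition polyhedron (pos : V -> 'rV[R]_3) (K : {set {set V}}) : set 'rV[R]_3 :=
  [set x | exists2 s, s \in K & conv_hull pos s x].

End GeomK.

Section Geom.
Local Open Scope classical_set_scope.
Variable R : realType.

Definition edist (x y : 'rV[R]_3) : R := Num.sqrt (\sum_i (x ord0 i - y ord0 i) ^+ 2).

Definition closed_unit_ball : set 'rV[R]_3 := [set x | \sum_i (x ord0 i) ^+ 2 <= 1].

Definition homeomorphic (A B : set 'rV[R]_3) : Prop :=
  exists f g : 'rV[R]_3 -> 'rV[R]_3,
    [/\ f @` A `<=` B /\ g @` B `<=` A,
        (forall x, A x -> g (f x) = x), (forall y, B y -> f (g y) = y),
        {within A, continuous f} & {within B, continuous g}].

Definition lipschitz2 (g : R -> R -> R) : Prop :=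
  exists L : R, forall a b c d,
    `|g a b - g c d| <= L * Num.sqrt ((a - c) ^+ 2 + (b - d) ^+ 2).

Definition lipschitz_boundary (O : set 'rV[R]_3) : Prop :=
  forall x, (closure O `\` interior O) x ->
    exists (r : R) (Q : 'M[R]_3) (g : R -> R -> R),
      [/\ 0 < r, Q *m Q^T = 1%:M, lipschitz2 g &
          forall y, edist y x < r ->
            (O y <-> let z := (y - x) *m Q in
                     z ord0 (inord 2) <= g (z ord0 (inord 0)) (z ord0 (inord 1)))].

End Geom.

(* Main.v *)
(** The topological input is that the reduced simplicial cohomology of K mod 2 vanishes.
   A cochain on K becomes a function on small tuples of points of |K| once every point is
   labelled by a vertex that belongs to all simplices near it. Transported to the ball,
   such a cocycle gets a primitive from the homotopy x |-> (j/N) x, taken in N small steps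
   so that all tuples stay small. Pulling the primitive back to K along an iterated
   barycentric subdivision gives a simplicial primitive, by Sperner's lemma.

   Let C have rank r and let n_j count the j-simplices. Integer minors compare the real and
   the mod 2 rank, and exactness gives r = n_1 - n_0 + 1 and n_2 - r <= n_3. The edge-triangle
   pairs of a collapse form an acyclic matching with n_1 - n_0 + 1 pairs. Conversely, let a
   complete acyclic matching be given. A triangle of an embedded complex lies in at most two
   tetrahedra, there is no 3-cycle mod 2, and matched triangles support no 2-cycle; hence
   the tetrahedra can be removed one by one through unmatched triangles. There are at most
   n_3 of these, so only matched triangles remain, and acyclicity lets them collapse through
   their edges. What is left is a connected graph with fewer edges than vertices: a tree. *)
Require Import Defs.
From HB Require Import structures.
From mathcomp Require Import all_boot all_order all_algebra.
From mathcomp Require Import boolp ring lra zify.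
Set Implicit Arguments. Unset Strict Implicit. Unset Printing Implicit Defensive.
Import Order.TTheory GRing.Theory Num.Theory.
Local Open Scope ring_scope.

(** * Cochains mod 2 *)

Lemma addrr_F2 (x : 'F_2) : x + x = 0.
Proof. by rewrite addrr_pchar2 // pchar_Fp. Qed.

Section ListCochains.
Variable T : eqType.
Implicit Types (a b : seq T -> 'F_2) (xs ys : seq T).

(* The empty list is allowed as an argument, so the cohomology is the reduced one. *)
Fixpoint cobd a xs : 'F_2 :=
  if xs is x :: xs' then a xs' + cobd (fun ys => a (x :: ys)) xs' else 0.

Lemma cobd_ext a b xs :
  (forall ys, size ys = (size xs).-1 -> {subset ys <= xs} -> a ys = b ys) ->
  cobd a xs = cobd b xs.
Proof.
elim: xs a b => [|x xs IH] a b E //=.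
rewrite E //; last by move=> y ys; rewrite inE ys orbT.
congr (_ + _); case: xs IH E => [//|x' xs] IH E; apply: IH => ys sz sub.
apply: E => [|y]; first by rewrite /= sz.
by rewrite !inE => /orP[->//|/sub]; rewrite inE => ->; rewrite orbT.
Qed.

Lemma cobd0 xs : cobd (fun=> 0) xs = 0.
Proof. by elim: xs => //= x xs ->; rewrite addr0. Qed.

Lemma cobdD a b xs : cobd (fun ys => a ys + b ys) xs = cobd a xs + cobd b xs.
Proof.
elim: xs a b => [|x xs IH] a b /=; first by rewrite addr0.
by rewrite (IH (fun ys => a (x :: ys))) addrACA.
Qed.

Lemma cobd_sum N (A : 'I_N -> seq T -> 'F_2) xs :
  cobd (fun ys => \sum_(i < N) A i ys) xs = \sum_(i < N) cobd (A i) xs.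
Proof.
elim: xs A => [|x xs IH] A /=; first by rewrite big1.
by rewrite (IH (fun i ys => A i (x :: ys))) big_split.
Qed.

Lemma cobdK a xs : cobd (cobd a) xs = 0.
Proof.
elim: xs a => [|x xs IH] a //=.
by rewrite cobdD IH addr0 addrr_F2.
Qed.

Section Prism.
Variables f g : T -> T.

(* Pull-back of [a] along the triangulated homotopy from [f] to [g]. *)
Fixpoint prism a xs : 'F_2 :=
  if xs is x :: xs' then
    a [:: f x, g x & map g xs'] + prism (fun ys => a (f x :: ys)) xs'
  else 0.

Lemma prismD a b xs : prism (fun ys => a ys + b ys) xs = prism a xs + prism b xs.
Proof.
elim: xs a b => [|x xs IH] a b /=; first by rewrite addr0.
by rewrite (IH (fun ys => a (f x :: ys))) addrACA.
Qed.

Lemma prism_eq0 a xs :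
  (forall ys, size ys = (size xs).+1 ->
     (forall y, y \in ys -> exists2 x, x \in xs & y = f x \/ y = g x) -> a ys = 0) ->
  prism a xs = 0.
Proof.
elim: xs a => [|x xs IH] a H //=.
rewrite H ?add0r ?IH //=; last 2 first.
- by rewrite size_map.
- move=> y; rewrite !inE => /or3P[/eqP->|/eqP->|/mapP[z zxs ->]].
  + by exists x; [rewrite inE eqxx|left].
  + by exists x; [rewrite inE eqxx|right].
  + by exists z; [rewrite inE zxs orbT|right].
move=> ys sz sub; apply: H => [|y]; first by rewrite /= sz.
rewrite inE => /orP[/eqP->|/sub[z zxs e]].
  by exists x; [rewrite inE eqxx|left].
by exists z => //; rewrite inE zxs orbT.
Qed.

End Prism.

End ListCochains.

Lemma cobd_comp_map (T U : eqType) (h : U -> T) (a : seq T -> 'F_2) us :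
  cobd (fun ys => a (map h ys)) us = cobd a (map h us).
Proof. by elim: us a => [|u us IH] a //=; rewrite -IH. Qed.

(** The homotopy formula: a prism is bounded by its bottom, its top and the prism over the boundary
    of its base. Mod 2 no signs arise. *)
Lemma cobd_prism (T : eqType) (f g : T -> T) a xs :
  cobd (prism f g a) xs + prism f g (cobd a) xs = a (map f xs) + a (map g xs).
Proof.
elim: xs a => [|x xs IH] a /=; first by rewrite addr0 addrr_F2.
rewrite cobdD prismD (cobd_comp_map g (fun ys => a [:: f x, g x & ys])).
have := IH (fun ys => a (f x :: ys)) => /=.
set A := prism f g a xs; set B := cobd _ (map g xs); set D := cobd _ xs.
set E := prism _ _ _ _; set G := a (f x :: _); set H := a (g x :: _).
set L := a (f x :: _).
move: A B D E G H L => A B D E G H L DE.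
have -> : A + (B + D) + (H + (L + B) + (A + E)) =
          (A + A) + (B + B) + (D + E) + L + H by ring.
by rewrite DE !addrr_F2 !add0r -(addrA G) addrr_F2 addr0.
Qed.

(** * Barycentric subdivision of cochains *)

Section Subdivision.
Variables (T : eqType) (bary : seq T -> T).
Implicit Types (a b : seq T -> 'F_2) (xs ys : seq T).

(* [sdn n] is meaningful on lists of size [n] only: it pulls [b] back along the
   barycentric subdivision, i.e. the cone from [bary xs] over the subdivided boundary. *)
Fixpoint sdn n b xs : 'F_2 :=
  if n is m.+1 then cobd (sdn m (fun ys => b (bary xs :: ys))) xs else b xs.

Definition sd b xs := sdn (size xs) b xs.

Lemma sdnD n a b xs : sdn n (fun ys => a ys + b ys) xs = sdn n a xs + sdn n b xs.
Proof.
elim: n a b xs => [//|n IH] a b xs /=.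
by rewrite -cobdD; apply: cobd_ext => ys _ _; rewrite -IH.
Qed.

(** The boundary of a cone is its base plus the cone over the boundary of the base; the second part
    contributes a double coboundary, which vanishes. *)
Lemma sdn_cobd n b xs : size xs = n.+1 -> sdn n.+1 (cobd b) xs = cobd (sdn n b) xs.
Proof.
elim: n b xs => [|n IH] b xs sxs.
  by case: xs sxs => // x [] //= _; rewrite !addr0.
change (cobd (sdn n.+1 (fun ys => b ys + cobd (fun zs => b (bary xs :: zs)) ys)) xs =
        cobd (sdn n.+1 b) xs).
rewrite -[RHS]addr0 -(cobdK (sdn n (fun ys => b (bary xs :: ys))) xs) -cobdD.
apply: cobd_ext => ys; rewrite sxs => sys _.
by rewrite -(IH (fun zs => b (bary xs :: zs))) // -sdnD.
Qed.

Lemma sd_cobd b : sd (cobd b) = cobd (sd b).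
Proof.
apply: funext => xs; rewrite /sd; case E: (size xs) => [|n].
  by move/size0nil: E => ->.
by rewrite sdn_cobd //; apply: cobd_ext => ys; rewrite E => /= ->.
Qed.

Lemma iter_sd_cobd N b : iter N sd (cobd b) = cobd (iter N sd b).
Proof. by elim: N => //= N ->; rewrite sd_cobd. Qed.

Lemma iter_sd_nil N b : iter N sd b [::] = b [::].
Proof. by elim: N. Qed.

End Subdivision.

(** * Simplicial cochains as cochains on vertex lists *)

Section SimplicialCochains.
Variable V : finType.
Implicit Types (b c : {set V} -> 'F_2) (vs : seq V) (s t : {set V}).

Definition scobd b s : 'F_2 := \sum_(v in s) b (s :\ v).

(** Lists with a repeated vertex are degenerate and get 0; mod 2 the order of the vertices carries
    no sign. *)
Definition lcochain c vs : 'F_2 := if uniq vs then c [set:: vs] else 0.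

(** In a list with a repetition, only deleting one of two equal vertices can leave distinct
    vertices; both deletions give the same set and cancel mod 2. *)
Lemma cobd_lcochain b vs : cobd (lcochain b) vs = lcochain (scobd b) vs.
Proof.
elim: vs b => [|v vs IH] b /=.
  by rewrite /lcochain /= /scobd set_nil big_set0.
(* [b'] is [b] with [v] adjoined, set to 0 on sets that already contain [v]. *)
pose b' s := if v \in s then 0 else b (v |: s).
have -> : (fun ys => lcochain b (v :: ys)) = lcochain b'.
  apply: funext => ys; rewrite /lcochain /= /b' inE set_cons.
  by case: (v \in ys) => //=; case: ifP.
rewrite IH /lcochain /=; case: ifP => [u|]; last by rewrite andbF addr0.
rewrite andbT set_cons; set S := [set:: vs].
have -> : (v \in vs) = (v \in S) by rewrite inE.
have [vS|vS] /= := boolP (v \in S).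
  rewrite /scobd (bigD1 v) //= big1 ?addr0 => [|w /andP[wS wv]].
    by rewrite /b' in_setD1 eqxx /= setD1K // addrr_F2.
  by rewrite /b' in_setD1 eq_sym wv vS.
rewrite /scobd big_setU1 //= setU1K //; congr (_ + _); apply: eq_bigr => w wS.
have wv : w != v by apply: contraNneq vS => <-.
rewrite /b' in_setD1 (negPf vS) andbF; congr b; apply/setP => x; rewrite !inE.
by have [->|] //= := eqVneq x v; rewrite eq_sym wv.
Qed.

Lemma cobd_uniq (g : seq V -> 'F_2) vs : uniq vs ->
  cobd g vs = \sum_(v <- vs) g (rem v vs).
Proof.
elim: vs g => [|v vs IH] g /=; first by rewrite big_nil.
case/andP=> vN u; rewrite big_cons /= eqxx IH //; congr (_ + _).
apply: eq_big_seq => w wvs; case: eqP => // e; by rewrite e wvs in vN.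
Qed.

Lemma cobd_enum (g : seq V -> 'F_2) s :
  cobd g (enum s) = \sum_(v in s) g (enum (s :\ v)).
Proof.
rewrite cobd_uniq ?enum_uniq // big_enum; apply: eq_bigr => v vs.
congr g; rewrite rem_filter ?enum_uniq //.
rewrite [in LHS]/enum_mem -filter_predI /enum_mem; apply: eq_filter => x.
by rewrite /= !inE.
Qed.

End SimplicialCochains.

(** * Collapses and matchings *)

Section Collapses.
Variable V : finType.
Implicit Types (K : {set {set V}}) (s t u e f : {set V}) (M : {set {set V} * {set V}}).

Lemma simplicesP K j s : reflect (s \in K /\ #|s| = j.+1) (s \in simplices K j).
Proof. by rewrite inE; apply: (iffP andP) => -[? /eqP]. Qed.

Lemma collapses_trans K K1 K2 :
  collapses_to K K1 -> collapses_to K1 K2 -> collapses_to K K2.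
Proof. by move=> H; elim=> // K3 K4 _ H3 H4; exact: collapses_step H3 H4. Qed.

Lemma elementary_collapse_complex K K' :
  is_simplicial_complex K -> elementary_collapse K K' -> is_simplicial_complex K'.
Proof.
move=> [K0 Kd] [s [t [[sK tK] st ct free ->]]]; split; first by rewrite !inE (negPf K0) !andbF.
move=> u w; rewrite !inE => /and3P[ut us uK] wu w0.
have pu : ~~ (s \proper u) by apply: contraNN ut => su; rewrite (free u).
rewrite (Kd u) // andbT; apply/andP; split; apply: contraNneq pu => e.
  by apply: proper_sub_trans st _; rewrite -e.
by rewrite properEneq eq_sym us -e.
Qed.

Lemma collapses_complex K K' :
  is_simplicial_complex K -> collapses_to K K' -> is_simplicial_complex K'.
Proof. by move=> h; elim=> // K1 K2 _; apply: elementary_collapse_complex. Qed.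

Lemma card_simplices_collapse K s t j : s \in K -> t \in K -> s \proper t ->
  (#|simplices K j| = (#|s| == j.+1) + ((#|t| == j.+1) + #|simplices ((K :\ s) :\ t) j|))%N.
Proof.
move=> sK tK st; rewrite (cardsD1 s) (cardsD1 t (_ :\ s)) !inE sK tK /=.
have -> : t != s by apply: contraTneq st => ->; rewrite properxx.
by congr (_ + (_ + _))%N; apply: eq_card => u; rewrite !inE -!andbA.
Qed.

(** Connectedness of the edge graph, stated through two-colourings so that no paths have to be
    constructed. *)
Definition conn K := forall col : V -> bool,
  (forall a b, [set a; b] \in K -> col a = col b) ->
  forall a b, [set a] \in K -> [set b] \in K -> col a = col b.

(** A removed free vertex can take the colour of its only neighbour, and a removed edge of a
    triangle is bypassed through the third vertex. *)
Lemma elementary_collapse_conn K K' :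
  is_simplicial_complex K -> elementary_collapse K K' -> conn K -> conn K'.
Proof.
move=> [K0 Kd] [s [t [[sK tK] st ct free ->]]] cK col colE a b.
rewrite !inE => /and3P[at_ as_ aK] /and3P[bt bs bK].
have s0 : (0 < #|s|)%N by rewrite card_gt0; apply: contraNneq K0 => <-.
have [s1|s1] := eqVneq #|s| 1%N.
  have /cards1P[x sx] : #|s| == 1%N by rewrite s1.
  have [y] : exists y, y \in t :\ x.
    apply/set0Pn; rewrite -card_gt0; move: ct; rewrite s1 (cardsD1 x).
    by case: (x \in t) => /=; clear; lia.
  rewrite !inE => /andP[yx yt].
  have xt : x \in t by move/proper_sub/subsetP: st; apply; rewrite sx inE.
  have tE : t = [set x; y].
    apply/eqP; rewrite eq_sym eqEcard ct s1 cards2 eq_sym yx andbT.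
    by apply/subsetP => z; rewrite !inE => /orP[]/eqP->.
  have colx z : [set x; z] \in K -> z != x -> z = y.
    move=> zK zx; have : [set x; z] = t.
      apply: free => //; rewrite sx properEcard cards1 cards2 eq_sym zx andbT.
      by rewrite sub1set !inE eqxx.
    rewrite tE => /setP/(_ z); rewrite !inE eqxx orbT (negPf zx) /= => /esym/eqP //.
  pose col' v := if v == x then col y else col v.
  have ax : a != x by apply: contraNneq as_ => ->; rewrite sx.
  have bx : b != x by apply: contraNneq bs => ->; rewrite sx.
  suff : col' a = col' b by rewrite /col' (negPf ax) (negPf bx).
  apply: cK => // p q pqK; rewrite /col'.
  have [px|px] := eqVneq p x; have [qx|qx] := eqVneq q x => //.
  - by rewrite (colx q) // -px.
  - by rewrite (colx p) // -qx setUC.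
  apply: colE; rewrite !inE pqK andbT sx tE; apply/andP; split.
    by apply: contraTneq (set21 x y) => <-; rewrite !inE !(eq_sym x) negb_or px.
  by apply: contraTneq (set11 x) => <-; rewrite !inE !(eq_sym x) negb_or px.
apply: cK => // p q pqK.
have [pq|pq] := eqVneq p q; first by rewrite pq.
have pqt : [set p; q] != t.
  by apply: contraTneq isT => e; move: ct s0 s1; rewrite -e cards2 pq; clear; lia.
have [pqs|pqs] := eqVneq [set p; q] s; last by apply: colE; rewrite !inE pqt pqs.
(* The removed edge is [s]; a vertex [r] of [t] outside [s] joins its two ends. *)
have [r rt rs] : exists2 r, r \in t & r \notin s by apply/subsetPn; case/andP: st.
have prP x : x \in s -> col x = col r.
  move=> xs; apply: colE; rewrite !inE (Kd t) //; last first.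
  - by apply/set0Pn; exists x; rewrite !inE eqxx.
  - apply/subsetP => z; rewrite !inE => /orP[]/eqP-> //.
    by move/proper_sub/subsetP: st; apply.
  have c2 : (#|[set x; r]| <= 2)%N by rewrite cards2; case: eqP.
  rewrite andbT; apply/andP; split.
    by apply: contraTneq c2 => ->; rewrite ct; move: s0 s1; clear; lia.
  by apply: contraNneq rs => <-; rewrite !inE eqxx orbT.
by rewrite !prP // -pqs !inE eqxx ?orbT.
Qed.

Lemma collapses_conn K K' :
  is_simplicial_complex K -> collapses_to K K' -> conn K -> conn K'.
Proof.
move=> h H cK; elim: H => // K1 K2 H1 IH.
by move=> /elementary_collapse_conn; apply => //; exact: collapses_complex H1.
Qed.

(** The matching collects the edge-triangle pairs removed so far. The count persists because a
    vertex-edge step lowers the edges and the vertices by one each, while an edge-triangle step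
    trades an edge for a pair. *)
Lemma collapses_matching K K' : is_simplicial_complex K -> collapses_to K K' ->
  exists M, [/\ matching1 K M, acyclic1 M,
    (forall p, p \in M -> p.1 \notin K' /\ p.2 \notin K'), K' \subset K &
    (#|M| + #|simplices K' 1| + #|simplices K 0| =
     #|simplices K 1| + #|simplices K' 0|)%N].
Proof.
move=> Kcx; elim=> [|K1 K2 H1 [M [mM aM M1 sub cM]] col].
  exists finset.set0; split => //; last by rewrite cards0 add0n addnC.
  - by split => p; rewrite inE.
  - by case=> -[|p c] [//= _ /andP[]]; rewrite inE.
  - by move=> p; rewrite inE.
have K1cx := collapses_complex Kcx H1.
case: (col) => s [t [[sK tK] st ct free K2E]].
have s0 : (0 < #|s|)%N.
  by rewrite card_gt0; apply: contraNneq (proj1 K1cx) => <-.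
have c0 := card_simplices_collapse 0 sK tK st.
have c1 := card_simplices_collapse 1 sK tK st.
have sub21 : K2 \subset K1 by rewrite K2E; apply: subset_trans (subD1set _ _) (subD1set _ _).
have M2 p : p \in M -> p.1 \notin K2 /\ p.2 \notin K2.
  by move=> /M1[h1 h2]; split; [apply: contraNN h1|apply: contraNN h2]; apply: (subsetP sub21).
rewrite -K2E ct in c0 c1.
have [s2|s2] := eqVneq #|s| 2%N; last first.
  exists M; split => //; first exact: subset_trans sub.
  by move: c0 c1 cM s2 s0; rewrite !eqSS; do 3!case: eqP; clear; lia.
have stM : (s, t) \notin M by apply: contraTN sK => /M1[].
exists ((s, t) |: M); split.
- case: mM => m1 m2 m3; split.
  + move=> p; rewrite !inE => /orP[/eqP->/=|/m1]; last by rewrite !inE.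
    by rewrite !(subsetP sub) // ct s2 (proper_sub st).
  + move=> p q; rewrite !inE => /orP[/eqP->|pM] /orP[/eqP->|qM] //=.
    * by move=> e; case: (M1 q qM); rewrite -e sK.
    * by move=> e; case: (M1 p pM); rewrite e sK.
    * exact: m2.
  + move=> p q; rewrite !inE => /orP[/eqP->|pM] /orP[/eqP->|qM] //=.
    * by move=> e; case: (M1 q qM); rewrite -e tK.
    * by move=> e; case: (M1 p pM); rewrite e tK.
    * exact: m3.
- case=> c [c2 /allP cM' uc cyc].
  have [stc|stc] := boolP ((s, t) \in c); last first.
    apply: aM; exists c; split => //; apply/allP => p pc.
    move: (cM' p pc); rewrite !inE => /orP[/eqP pe|//].
    by rewrite -pe pc in stc.
  set x0 := (finset.set0, finset.set0) in cyc.
  (* [j] is the cyclic predecessor of the position [i] of the new pair. The pair at [j] was removed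
     earlier, so its edge is gone from [K1]; yet that edge lies in [t], which is still present. *)
  pose i := index (s, t) c; pose j := if i is i'.+1 then i' else (size c).-1.
  have ic : (i < size c)%N by rewrite index_mem.
  have jc : (j < size c)%N by rewrite /j; case: (i) ic c2 => [|n]; clear; lia.
  have ji : (j.+1 %% size c)%N = i.
    rewrite /j; case: (i) ic c2 => [|n] h1 h2; last by rewrite modn_small.
    by rewrite prednK ?modnn //; move: h2; clear; lia.
  have jni : j <> i by rewrite /j; case: (i) ic c2 => [|n]; clear; lia.
  have := cyc j jc; rewrite ji nth_index //=.
  have jin : nth x0 c j \in c by apply: mem_nth.
  move: (cM' _ jin); rewrite !inE => /orP[/eqP e|jM] sub'.
    apply: jni; rewrite /i -e index_uniq //; exact: map_uniq uc.
  have [/simplicesP[eK ec] _ _] : [/\ (nth x0 c j).1 \in simplices K 1,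
     (nth x0 c j).2 \in simplices K 2 & (nth x0 c j).1 \subset (nth x0 c j).2].
    by case: mM => + _ _; apply.
  case: (M1 _ jM) => /negP + _; apply; apply: (proj2 K1cx t) => //.
  by rewrite -card_gt0 ec.
- move=> p; rewrite !inE => /orP[/eqP->|/M2 //].
  by rewrite K2E !inE !eqxx andbF.
- exact: subset_trans sub.
- rewrite cardsU1 stM; move: c0 c1 cM; rewrite s2 /=; clear; lia.
Qed.

(** Otherwise every pair of [A] has a successor, another pair whose triangle contains its edge, and
    following successors in the finite [A] closes a forbidden cycle. *)
Lemma acyclic_free_pair K M (A : {set {set V} * {set V}}) :
  matching1 K M -> acyclic1 M -> A \subset M -> A != finset.set0 ->
  exists2 p, p \in A & forall q, q \in A -> p.1 \subset q.2 -> q = p.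
Proof.
move=> [_ _ m3] aM /subsetP AM /set0Pn[p0 p0A].
apply: contrapT => H; apply: aM.
pose ok p q := [&& q \in A, q != p & p.1 \subset q.2].
pose nxt p := odflt p [pick q | ok p q].
have nxtP p : p \in A -> ok p (nxt p).
  move=> pA; rewrite /nxt; case: pickP => //= no; exfalso; apply: H.
  exists p => // q qA pq; apply/eqP; move: (no q); rewrite /ok qA pq andbT /=.
  by move=> /negbFE.
have itA n : iter n nxt p0 \in A by elim: n => //= n /nxtP/and3P[].
(* The orbit of [p0] enters a loop at position [k]. The loop has length at least two, since [ok]
   excludes fixed points of [nxt]. *)
have /trajectP[k kn kE] : looping nxt p0 (order nxt p0) by exact: looping_order.
pose c := drop k (orbit nxt p0).
have sc : size c = (order nxt p0 - k)%N by rewrite size_drop size_orbit.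
have nthc x i : (i < size c)%N -> nth x c i = iter (k + i) nxt p0.
  rewrite sc nth_drop => ic; rewrite /orbit (set_nth_default p0) ?nth_traject ?size_traject //;
  by move: ic; clear; lia.
have uc : uniq c by rewrite drop_uniq ?orbit_uniq.
have cA p : p \in c -> p \in A.
  by move=> /(nthP p0)[i ic <-]; rewrite nthc.
exists c; split.
- rewrite sc ltnNge; apply/negP => le1.
  have e : order nxt p0 = k.+1 by move: kn le1; clear; lia.
  have /and3P[_ /eqP + _] := nxtP _ (itA k); apply.
  by rewrite -iterS -e.
- by apply/allP => p /cA/AM.
- rewrite map_inj_in_uniq // => p q /cA/AM pM /cA/AM qM; exact: m3.
move=> i ic; rewrite !nthc ?ltn_pmod ?(leq_ltn_trans _ ic) //.
have /and3P[_ _] := nxtP _ (itA (k + i)%N); rewrite -iterS -addnS.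
have [lt|ge] := ltnP i.+1 (size c); first by rewrite modn_small.
have -> : i.+1 = size c by apply/eqP; rewrite eqn_leq ge andbT.
by rewrite modnn addn0 sc subnKC 1?ltnW // kE.
Qed.
End Collapses.

(** * Coboundaries as sums over faces, and boundaries of chains *)

Section Faces.
Variable V : finType.
Implicit Types (K : {set {set V}}) (s t f : {set V}).

Lemma scobdK (b : {set V} -> 'F_2) t : scobd (scobd b) t = 0.
Proof.
have := cobdK (lcochain b) (enum t).
have -> : cobd (lcochain b) = lcochain (scobd b) by apply: funext => vs; exact: cobd_lcochain.
rewrite cobd_lcochain /lcochain enum_uniq.
by have -> : [set:: enum t] = t by apply/setP => v; rewrite inE mem_enum.
Qed.

Lemma scobd_faces (b : {set V} -> 'F_2) t n : #|t| = n.+1 ->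
  scobd b t = \sum_(f : {set V} | (f \subset t) && (#|f| == n)) b f.
Proof.
move=> tn; rewrite /scobd -(big_imset b) /=; last first.
  by move=> u v ut vt /setP/(_ u); rewrite !inE eqxx ut andbT; case: eqP.
apply: eq_bigl => f; apply/imsetP/andP => [[v vt ->]|[ft /eqP fn]].
  by rewrite subD1set; move: tn; rewrite (cardsD1 v) vt add1n => -[->].
have /cards1P[v vE] : #|t :\: f| == 1%N.
  by rewrite cardsDS // tn fn subSnn.
exists v; first by have := set11 v; rewrite -vE inE => /andP[].
by rewrite -vE setDDr setDv set0U (setIidPr ft).
Qed.

(** The support of the mod 2 boundary of the chain [S]. *)
Definition odd_faces (K S : {set {set V}}) j :=
  [set f in simplices K j | odd #|[set t in S | f \subset t]|].

(** Stokes' formula mod 2: after exchanging the sums, [b f] is counted once for each simplex of [S]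
    that contains [f]. *)
Lemma sum_scobd K (S : {set {set V}}) j (b : {set V} -> 'F_2) :
  is_simplicial_complex K -> S \subset simplices K j.+1 ->
  \sum_(t in S) scobd b t = \sum_(f in odd_faces K S j) b f.
Proof.
move=> [_ Kd] /subsetP SK.
under eq_bigr => t /SK/simplicesP[tK tn] do rewrite (scobd_faces _ tn) big_mkcond.
rewrite exchange_big [RHS]big_mkcond; apply: eq_bigr => f _.
rewrite -big_mkcondr /=.
have -> : \sum_(t in S | (f \subset t) && (#|f| == j.+1)) b f =
    if #|f| == j.+1 then b f *+ #|[set t in S | f \subset t]| else 0.
  case: ifP => fj; last by rewrite big_pred0 // => t; rewrite andbF andbF.
  rewrite -sumr_const; apply: eq_bigl => t; by rewrite inE andbT.
rewrite !inE; set n := #|[set t in S | f \subset t]|.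
have dbl m : b f *+ m = if odd m then b f else 0.
  rewrite -{1}(odd_double_half m) mulrnDr -mul2n mulrnA mulr2n addrr_F2 mul0rn addr0.
  by case: (odd m).
have [fj|//] := eqVneq #|f| j.+1; last by rewrite andbF.
rewrite dbl andbT; have [on|] := boolP (odd n); last by rewrite andbF.
rewrite andbT; case: ifP => // /negP[].
have /set0Pn[t] : [set t in S | f \subset t] != finset.set0.
  by rewrite -card_gt0; case: #|_| @n on.
rewrite inE => /andP[/SK/simplicesP[tK _] ft]; apply: Kd ft _ => //.
by rewrite -card_gt0 fj.
Qed.

End Faces.

(** * Collapsing tetrahedra, then triangles, then a tree *)

Section Stages.
Variable V : finType.
Implicit Types (K : {set {set V}}) (s t u e f : {set V}) (M : {set {set V} * {set V}}).

Lemma card_simplices_collapse_other K s t j : s \in K -> t \in K -> s \proper t ->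
  #|s| <> j.+1 -> #|t| <> j.+1 -> #|simplices ((K :\ s) :\ t) j| = #|simplices K j|.
Proof.
move=> sK tK st h1 h2; rewrite (card_simplices_collapse j sK tK st).
by move/eqP/negPf: h1 => ->; move/eqP/negPf: h2 => ->.
Qed.

(* The tetrahedra are collapsed through unmatched triangles: if every odd face of
   the remaining tetrahedra were matched, these faces would form a 2-cycle of matched
   triangles, which acyclicity forbids. *)
Lemma collapse_tetrahedra K M :
  is_simplicial_complex K -> (forall s, s \in K -> #|s| <= 4)%N ->
  matching1 K M -> acyclic1 M ->
  (forall f, f \in simplices K 2 -> #|[set t in simplices K 3 | f \subset t]| <= 2)%N ->
  (forall t, t \in simplices K 3 -> exists b, forall u, u \in simplices K 3 ->
     scobd b u = (u == t)%:R) ->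
  exists K', [/\ collapses_to K K', simplices K' 3 = finset.set0, matching1 K' M,
    (#|simplices K' 2| + #|simplices K 3| = #|simplices K 2|)%N &
    [/\ K' \subset K, #|simplices K' 1| = #|simplices K 1| & #|simplices K' 0| = #|simplices K 0|]].
Proof.
move: {2}#|simplices K 3| (erefl #|simplices K 3|) => n.
elim: n K => [|n IH] K n3 Kcx K4 mM aM two H3.
  exists K; split => //; first exact: collapses_refl.
    by apply/eqP; rewrite -cards_eq0 n3.
  by rewrite n3 addn0.
set S := simplices K 3 in n3 two H3.
have SK : S \subset simplices K 3 by [].
have [t0 t0S] : exists t, t \in S by apply/set0Pn; rewrite -card_gt0 n3.
pose Z := odd_faces K S 2.
(* If [Z] were empty, every coboundary would sum to 0 over [S]; but the indicator of [t0] is a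
   coboundary on [S] and sums to 1. *)
have Z0 : Z != finset.set0.
  have [b bP] := H3 t0 t0S; apply/eqP => Z0.
  have := sum_scobd b Kcx SK; rewrite -/Z Z0 big_set0 (bigD1 t0) //= bP // eqxx.
  rewrite big1 => [|t /andP[tS /negPf tt0]]; last by rewrite bP // tt0.
  by move/eqP; rewrite addr0 oner_eq0.
have [f fZ fM] : exists2 f, f \in Z & f \notin [set p.2 | p in M].
  apply/subsetPn/negP => /subsetP ZM.
  pose A := [set p in M | p.2 \in Z].
  have A0 : A != finset.set0.
    case/set0Pn: Z0 => f fZ; have /imsetP[p pM fp] := ZM f fZ.
    by apply/set0Pn; exists p; rewrite inE pM -fp.
  have AM : A \subset M by apply/subsetP => p; rewrite inE => /andP[].
  have [p pA pfree] := acyclic_free_pair mM aM AM A0.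
  move: (pA); rewrite inE => /andP[pM pZ].
  have [/simplicesP[eK e2] /simplicesP[fK f3] ef] : [/\ p.1 \in simplices K 1,
     p.2 \in simplices K 2 & p.1 \subset p.2] by case: mM => + _ _; apply.
  (* Summed over [S], a double coboundary gives 0. For the indicator of the edge [p.1] this sum
     counts the triangles of [Z] that contain [p.1], and [p.2] is the only one. *)
  have := sum_scobd (scobd (fun e => (e == p.1)%:R)) Kcx SK.
  rewrite big1 => [|t _]; last exact: scobdK.
  have fE f : f \in Z -> scobd (fun e => (e == p.1)%:R) f = (p.1 \subset f)%:R.
    rewrite inE => /andP[/simplicesP[fK' f3'] _]; rewrite (scobd_faces _ f3') /=.
    have [pf|pf] := boolP (p.1 \subset f).
      rewrite (bigD1 p.1) /= ?pf ?e2 // eqxx big1 ?addr0 // => g /andP[_ /negPf->] //.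
    rewrite big1 // => g /andP[gf _]; case: eqP => // ge; by rewrite -ge gf in pf.
  rewrite -/Z (bigD1 p.2) //= fE // ef big1 ?addr0.
    by move/eqP; rewrite eq_sym oner_eq0.
  move=> g /andP[gZ gp]; rewrite fE //; case: (boolP (p.1 \subset g)) => // pg.
  have /imsetP[q qM gq] := ZM g gZ.
  have qA : q \in A by rewrite inE qM -gq.
  by case/eqP: gp; rewrite gq (pfree q) // -gq.
move: (fZ); rewrite inE => /andP[fS fodd].
(* An odd number at most 2 is 1, so [f] is a free face of [t]. *)
have /cards1P[t tE] : #|[set t in S | f \subset t]| == 1%N.
  by move: (two f fS) fodd; case: #|_| => [|[|[|]]].
have := set11 t; rewrite -tE inE => /andP[tS ft].
move: (fS) (tS) => /simplicesP[fK f3] /simplicesP[tK t4].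
have pft : f \proper t by rewrite properEcard ft f3 t4.
have free u : u \in K -> f \proper u -> u = t.
  move=> uK fu; apply/set1P; rewrite -tE !inE uK (proper_sub fu) andbT.
  by rewrite eqn_leq K4 //=; move: (proper_card fu); rewrite f3.
pose K1 := (K :\ f) :\ t.
have col : elementary_collapse K K1.
  by exists f, t; split => //; rewrite f3 t4.
have sub1 : K1 \subset K by apply: subset_trans (subD1set _ _) (subD1set _ _).
have subS j : simplices K1 j \subset simplices K j.
  by apply/subsetP => u; rewrite inE => /andP[/(subsetP sub1) uK uj]; rewrite inE uK.
have c3 : n.+1 = #|simplices K1 3|.+1.
  by rewrite -n3 /S (card_simplices_collapse 3 fK tK pft) f3 t4.
have c2 : #|simplices K 2| = #|simplices K1 2|.+1.
  by rewrite (card_simplices_collapse 2 fK tK pft) f3 t4.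
have [|||||||K' [h1 h2 h3 h4 [h5 h6 h7]]] := IH K1.
- by case: c3.
- exact: elementary_collapse_complex col.
- by move=> s /(subsetP sub1)/K4.
- case: mM => m1 m2 m3; split => // p pM.
  have [/simplicesP[p1 p1c] /simplicesP[p2 p2c] ps] := m1 p pM.
  split => //; apply/simplicesP; split => //; rewrite !inE ?p1 ?p2 andbT; apply/andP; split;
    try by apply: contra_eq_neq p1c => ->; rewrite ?f3 ?t4.
    by apply: contra_eq_neq p2c => ->; rewrite ?f3 ?t4.
  by apply: contraNneq fM => <-; apply: imset_f.
- by [].
- move=> g /(subsetP (subS 2))/two; apply: leq_trans; apply: subset_leq_card.
  apply/subsetP => u; rewrite inE => /andP[/(subsetP (subS 3)) uS gu].
  by rewrite inE gu andbT.
- move=> u /(subsetP (subS 3)) /H3 [b bP]; exists b => w /(subsetP (subS 3)); exact: bP.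
exists K'; split => //.
- by apply: collapses_trans h1; apply: collapses_step col; exact: collapses_refl.
- by rewrite -/S; move: c2 c3 h4; rewrite n3; clear; lia.
- split; [exact: subset_trans sub1| |].
    by rewrite h6; apply: card_simplices_collapse_other; rewrite ?f3 ?t4.
  by rewrite h7; apply: card_simplices_collapse_other; rewrite ?f3 ?t4.
Qed.

(** Every triangle is matched by [A], so acyclicity yields an edge that lies in its own triangle
    only, a free face. [A] shrinks with the complex and inherits acyclicity from the fixed [M]. *)
Lemma collapse_triangles K M (A : {set {set V} * {set V}}) :
  is_simplicial_complex K -> (forall s, s \in K -> #|s| <= 3)%N ->
  acyclic1 M -> A \subset M -> matching1 K A ->
  simplices K 2 = [set p.2 | p in A] ->
  exists K', [/\ collapses_to K K', simplices K' 2 = finset.set0, K' \subset K,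
    (#|simplices K' 1| + #|A| = #|simplices K 1|)%N &
    #|simplices K' 0| = #|simplices K 0|].
Proof.
move: {2}#|A| (erefl #|A|) => n; elim: n K A => [|n IH] K A nA Kcx K3 aM AM mA KA.
  have A0 : A = finset.set0 by apply/eqP; rewrite -cards_eq0 nA.
  exists K; split => //; [exact: collapses_refl|by rewrite KA A0 imset0|by rewrite nA addn0].
have A0 : A != finset.set0 by rewrite -card_gt0 nA.
have aA : acyclic1 A.
  move=> [c [h1 /allP h2 h3 h4]]; apply: aM; exists c; split => //.
  by apply/allP => p /h2/(subsetP AM).
have [p pA pfree] := acyclic_free_pair mA aA (subxx _) A0.
case: (mA) => m1 m2 m3.
have [/simplicesP[eK e2] /simplicesP[fK f3] ef] := m1 p pA.
have pef : p.1 \proper p.2 by rewrite properEcard ef e2 f3.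
have free u : u \in K -> p.1 \proper u -> u = p.2.
  move=> uK pu; have : u \in simplices K 2.
    apply/simplicesP; split => //; apply/eqP; rewrite eqn_leq K3 //=.
    by move: (proper_card pu); rewrite e2.
  by rewrite KA => /imsetP[q qA uq]; rewrite uq (pfree q) // -uq proper_sub.
pose K1 := (K :\ p.1) :\ p.2.
have col : elementary_collapse K K1 by exists p.1, p.2; split => //; rewrite f3 e2.
have sub1 : K1 \subset K by apply: subset_trans (subD1set _ _) (subD1set _ _).
have c1 : #|simplices K 1| = #|simplices K1 1|.+1.
  by rewrite (card_simplices_collapse 1 eK fK pef) e2 f3.
have cA : n.+1 = #|A :\ p|.+1 by rewrite -nA (cardsD1 p A) pA.
have [|||||||K' [h1 h2 h3 h4 h5]] := IH K1 (A :\ p).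
- by case: cA.
- exact: elementary_collapse_complex col.
- by move=> s /(subsetP sub1)/K3.
- by [].
- exact: subset_trans (subD1set _ _) AM.
- split; [|by move=> q r; rewrite !inE => /andP[_ +] /andP[_ +]; exact: m2
          |by move=> q r; rewrite !inE => /andP[_ +] /andP[_ +]; exact: m3].
  move=> q; rewrite !inE => /andP[qp qA].
  have [/simplicesP[q1 q1c] /simplicesP[q2 q2c] qs] := m1 q qA.
  have n1 : q.1 != p.1 by apply: contraNneq qp => /(m2 _ _ qA pA) ->.
  have n2 : q.2 != p.2 by apply: contraNneq qp => /(m3 _ _ qA pA) ->.
  have n3 : q.1 != p.2 by apply: contra_eq_neq q1c => ->; rewrite f3.
  have n4 : q.2 != p.1 by apply: contra_eq_neq q2c => ->; rewrite e2.
  by rewrite n1 n2 n3 n4 q1 q2 q1c q2c qs.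
- apply/setP => u; apply/idP/imsetP.
    rewrite !inE -!andbA => /and4P[up2 up1 uK u3].
    have : u \in simplices K 2 by rewrite inE uK.
    rewrite KA => /imsetP[q qA uq]; exists q => //; rewrite !inE qA andbT.
    by apply: contraNneq up2 => <-; rewrite uq.
  case=> q; rewrite !inE => /andP[qp qA] ->.
  have [_ /simplicesP[q2 q2c] _] := m1 q qA.
  have n2 : q.2 != p.2 by apply: contraNneq qp => /(m3 _ _ qA pA) ->.
  have n4 : q.2 != p.1 by apply: contra_eq_neq q2c => ->; rewrite e2.
  by rewrite n2 n4 q2 q2c.
exists K'; split => //.
- by apply: collapses_trans h1; apply: collapses_step col; exact: collapses_refl.
- exact: subset_trans sub1.
- by move: c1 h4 cA; rewrite nA; clear; lia.
- by rewrite h5; apply: card_simplices_collapse_other; rewrite ?f3 ?e2.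
Qed.

(** With fewer edges than vertices, some vertex has degree below two. Connectedness makes it a leaf
    unless it is the only vertex, and a leaf collapses with its edge. *)
Lemma collapse_tree K : is_simplicial_complex K -> (forall s, s \in K -> #|s| <= 2)%N ->
  conn K -> (0 < #|simplices K 0|)%N -> (#|simplices K 1| < #|simplices K 0|)%N ->
  collapsible K.
Proof.
move: {2}#|simplices K 0| (erefl #|simplices K 0|) => n.
elim: n K => [|n IH] K n0 Kcx K2 cK; first by rewrite n0.
move=> _ lt.
have sz s : s \in K -> (0 < #|s|)%N.
  by move=> sK; rewrite card_gt0; apply: contraNneq (proj1 Kcx) => <-.
case: n IH n0 => [|n] IH n0.
  have /cards1P[s sE] : #|simplices K 0| == 1%N by rewrite n0.
  have := set11 s; rewrite -sE => /simplicesP[sK /eqP/cards1P[v sv]].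
  exists v; suff -> : [set [set v]] = K by exact: collapses_refl.
  apply/setP => t; rewrite -sv -sE inE andb_idr // => tK.
  rewrite eqn_leq sz // andbT leqNgt; apply/negP => t2.
  have : t \in simplices K 1 by apply/simplicesP; split => //; apply/eqP; rewrite eqn_leq K2.
  by move: lt; rewrite n0 ltnS leqn0 cards_eq0 => /eqP ->; rewrite inE.
pose deg s := #|[set e in simplices K 1 | s \subset e]|.
have [s sK0 ds] : exists2 s, s \in simplices K 0 & (deg s < 2)%N.
  apply: contrapT => H.
  have h1 : (\sum_(s in simplices K 0) 2 <= \sum_(s in simplices K 0) deg s)%N.
    by apply: leq_sum => s sK; rewrite leqNgt; apply/negP => h; apply: H; exists s.
  have cnt (A : {set {set V}}) (P : pred {set V}) :
      (\sum_(e in A) P e = #|[set e in A | P e]|)%N.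
    by rewrite -sum1dep_card big_mkcondr; apply: eq_bigr => e _; case: (P e).
  have h2 : (\sum_(s in simplices K 0) deg s <= \sum_(e in simplices K 1) 2)%N.
    have -> : (\sum_(s in simplices K 0) deg s =
       \sum_(s in simplices K 0) \sum_(e in simplices K 1) (s \subset e))%N.
      by apply: eq_bigr => s _; rewrite cnt.
    rewrite exchange_big; apply: leq_sum => e /simplicesP[eK e2].
    rewrite cnt -e2; apply: leq_trans (leq_imset_card set1 e); apply: subset_leq_card.
    apply/subsetP => s; rewrite !inE => /andP[/andP[_ /cards1P[v ->]]].
    by rewrite sub1set; apply: imset_f.
  by have := leq_trans h1 h2; rewrite !sum_nat_const leq_pmul2r // leqNgt lt.
have /simplicesP[sK /eqP/cards1P[v sv]] := sK0.
have [d0|d0] := posnP (deg s).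
  have [w ws] : exists w, w \in simplices K 0 :\ s.
    by apply/set0Pn; rewrite -card_gt0; move: n0; rewrite (cardsD1 s) sK0; clear; lia.
  move: ws; rewrite !inE => /and3P[ws wK /cards1P[x wx]].
  have := cK (pred1 v) _ v x; rewrite -sv -wx sK wK /= eqxx => H.
  have xv : x != v by apply: contraNneq ws => xv; rewrite wx xv sv.
  suff : true = (x == v) by rewrite (negPf xv).
  apply: H => // a b abK; have [->//|ab] := eqVneq a b.
  have eab : [set a; b] \in simplices K 1 by apply/simplicesP; rewrite cards2 ab.
  have : [set a; b] \notin [set e in simplices K 1 | s \subset e].
    by move/eqP: d0; rewrite cards_eq0 => /eqP ->; rewrite inE.
  rewrite inE eab /= sv sub1set !inE negb_or !(eq_sym v) => /andP[/negPf-> /negPf->] //.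
have /cards1P[e eE] : #|[set e in simplices K 1 | s \subset e]| == 1%N.
  by move: ds d0; rewrite /deg; clear; lia.
have := set11 e; rewrite -eE inE => /andP[/simplicesP[eK e2] se].
have s1 : #|s| = 1%N by rewrite sv cards1.
have pse : s \proper e by rewrite properEcard se s1 e2.
have free u : u \in K -> s \proper u -> u = e.
  move=> uK su; apply/set1P; rewrite -eE !inE uK (proper_sub su) andbT.
  by rewrite eqn_leq K2 //=; move: (proper_card su); rewrite s1.
pose K1 := (K :\ s) :\ e.
have col : elementary_collapse K K1 by exists s, e; split => //; rewrite s1 e2.
have c0 : #|simplices K 0| = #|simplices K1 0|.+1.
  by rewrite (card_simplices_collapse 0 sK eK pse) s1 e2.
have c1 : #|simplices K 1| = #|simplices K1 1|.+1.
  by rewrite (card_simplices_collapse 1 sK eK pse) s1 e2.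
have [||||||v' h] := IH K1.
- by move: c0; rewrite n0; clear; lia.
- exact: elementary_collapse_complex col.
- by move=> u; rewrite !inE => /and3P[_ _ /K2].
- exact: elementary_collapse_conn col cK.
- by move: c0; rewrite n0; clear; lia.
- by move: c0 c1 lt; clear; lia.
exists v'; apply: collapses_trans h; apply: collapses_step col; exact: collapses_refl.
Qed.

End Stages.

(** * Ranks of incidence matrices *)

Lemma mxrank_mxsub (F : fieldType) m n m' n' (f : 'I_m' -> 'I_m) (g : 'I_n' -> 'I_n)
  (A : 'M[F]_(m, n)) : (\rank (mxsub f g A) <= \rank A)%N.
Proof.
have rs p q q' (h : 'I_q' -> 'I_q) (B : 'M[F]_(q, p)) : (\rank (rowsub h B) <= \rank B)%N.
  exact: mxrankS (rowsub_sub _ _).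
have -> : mxsub f g A = (rowsub g (rowsub f A)^T)^T.
  by apply/matrixP => i j; rewrite !mxE.
by rewrite mxrank_tr (leq_trans (rs _ _ _ _ _)) // mxrank_tr rs.
Qed.

(** A nonsingular mod 2 minor of maximal size has an odd integer determinant, which is nonzero in
    characteristic 0. *)
Lemma rank_mod2_le (R : numFieldType) m n (A : 'M[int]_(m, n)) :
  (\rank (map_mx (intr : int -> 'F_2) A) <= \rank (map_mx (intr : int -> R) A))%N.
Proof.
set B := map_mx (intr : int -> 'F_2) A; pose f := maxrankfun B.
have fl : row_full (rowsub f B)^T.
  by rewrite /row_full mxrank_tr; have := maxrowsub_free B; rewrite /row_free.
pose g := fullrankfun fl.
have uB : mxsub f g B \in unitmx.
  have -> : mxsub f g B = (rowsub g (rowsub f B)^T)^T.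
    by apply/matrixP => i j; rewrite !mxE.
  by rewrite unitmx_tr fullrowsub_unit.
have dA : \det (mxsub f g A) != 0.
  apply: contraTneq uB => d0; rewrite unitmxE -map_mxsub det_map_mx d0 rmorph0.
  by rewrite unitr0.
have uA : mxsub f g (map_mx (intr : int -> R) A) \in unitmx.
  by rewrite unitmxE -map_mxsub det_map_mx unitfE intr_eq0.
by rewrite -{1}(mxrank_unit uA) mxrank_mxsub.
Qed.

Section Ranks.
Variables (V : finType) (K : {set {set V}}) (or : {set V} -> bool).
Hypothesis Kcx : is_simplicial_complex K.

(** For positive [m], the vanishing of reduced mod 2 cohomology in dimension [m - 1]: the index
    counts vertices, and for [m = 1] the primitive is a value on the empty set. *)
Definition exact_at m := forall c : {set V} -> 'F_2,
  (forall t, t \in K -> #|t| = m.+1 -> scobd c t = 0) ->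
  exists b, forall s, s \in K -> #|s| = m -> scobd b s = c s.

(** Acting on row vectors, [face_mx j j.+1] is the mod 2 coboundary. *)
Definition face_mx j k : 'M['F_2]_(#|simplices K j|, #|simplices K k|) :=
  \matrix_(i, l) ((enum_val i : {set V}) \subset (enum_val l : {set V}))%:R.

Lemma scobd_simplices j (b : {set V} -> 'F_2) t : t \in simplices K j.+1 ->
  scobd b t = \sum_(i < #|simplices K j|) b (enum_val i) * (enum_val i \subset t)%:R.
Proof.
move=> /simplicesP[tK tj]; rewrite (scobd_faces _ tj).
rewrite -(big_enum_val (fun f => b f * (f \subset t)%:R)) /=.
rewrite big_mkcond [RHS]big_mkcond; apply: eq_bigr => f _.
rewrite inE; have [ft|ft] /= := boolP (f \subset t); last by rewrite mulr0 if_same.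
rewrite mulr1; have [fj|] := eqVneq #|f| j.+1; last by rewrite andbF.
by rewrite andbT (proj2 Kcx t) // -card_gt0 fj.
Qed.

(** Rank-nullity: the cocycles form the kernel of the second matrix, and exactness puts them in the
    row space of the first. *)
Lemma exact_rank j : exact_at j.+2 ->
  (#|simplices K j.+1| <= \rank (face_mx j j.+1) + \rank (face_mx j.+1 j.+2))%N.
Proof.
move=> ex; rewrite addnC -leq_subLR -mxrank_ker; apply: mxrankS.
apply/row_subP => i; have := row_sub i (kermx (face_mx j.+1 j.+2)).
move: (row i _) => x /sub_kermxP x0.
pose c s := \sum_(l < #|simplices K j.+1|) x 0 l * (enum_val l == s)%:R.
have cE l : c (enum_val l) = x 0 l.
  rewrite /c (bigD1 l) //= eqxx mulr1 big1 ?addr0 // => k kl.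
  by rewrite (inj_eq enum_val_inj) (negPf kl) mulr0.
have [t tK tj|b bP] := ex c.
  have tS : t \in simplices K j.+2 by apply/simplicesP.
  have /rowP/(_ (enum_rank_in tS t)) := x0; rewrite !mxE => <-.
  rewrite (scobd_simplices c tS); apply: eq_bigr => l _.
  by rewrite cE mxE enum_rankK_in.
apply/submxP; exists (\row_l b (enum_val l)); apply/rowP => l.
have lS := enum_valP l; have /simplicesP[lK lj] := lS.
rewrite -cE -bP // (scobd_simplices b lS) mxE; apply: eq_bigr => k _.
by rewrite !mxE.
Qed.

Lemma face_edge_matrix_mod2 : face_edge_matrix 'F_2 K or = (face_mx 1 2)^T.
Proof.
apply/matrixP => i l; rewrite !mxE /incidence; case: ifP => // _.
have -> : -1 = 1 :> 'F_2 by apply/val_inj.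
by rewrite expr1n.
Qed.

Lemma face_edge_matrix_intr (R : nzRingType) :
  face_edge_matrix R K or = map_mx intr (face_edge_matrix int K or).
Proof.
apply/matrixP => i l; rewrite !mxE /incidence; case: ifP => _; last by rewrite rmorph0.
by rewrite rmorphXn rmorphN1.
Qed.

Lemma rank_face_edge_ge (R : numFieldType) :
  (\rank (face_mx 1 2) <= \rank (face_edge_matrix R K or))%N.
Proof.
rewrite -mxrank_tr -face_edge_matrix_mod2 (face_edge_matrix_intr 'F_2)
  (face_edge_matrix_intr R).
exact: rank_mod2_le.
Qed.

Lemma triangles_rank_le : exact_at 3 ->
  (#|simplices K 2| <= \rank (face_mx 1 2) + #|simplices K 3|)%N.
Proof.
by move/(@exact_rank 1)/leq_trans; apply; rewrite leq_add2l rank_leq_col.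
Qed.

(** The vertex-edge coboundary has rank below the number of vertices, since it kills the constant
    cochain 1: every edge has two ends. *)
Lemma edges_rank_lt : exact_at 2 -> (0 < #|simplices K 0|)%N ->
  (#|simplices K 1| < \rank (face_mx 1 2) + #|simplices K 0|)%N.
Proof.
move=> /(@exact_rank 0) h n0; apply: leq_ltn_trans h _.
rewrite addnC ltn_add2l ltn_neqAle rank_leq_row andbT.
apply/negP => fr; have : row_free (face_mx 0 1) by [].
move/row_freeP => [B fB].
have one : const_mx 1 *m face_mx 0 1 = 0 :> 'rV_ _.
  apply/rowP => l; rewrite !mxE.
  have := scobd_simplices (fun=> 1) (enum_valP l).
  have /simplicesP[_ c2] := enum_valP l.
  rewrite /scobd sumr_const c2 => e.
  transitivity (1 *+ 2 : 'F_2); last by rewrite mulr2n addrr_F2.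
  by rewrite e; apply: eq_bigr => i _; rewrite !mxE.
have /rowP/(_ (Ordinal n0)) : const_mx 1 = 0 :> 'rV['F_2]_#|simplices K 0|.
  by rewrite -[LHS]mulmx1 -fB mulmxA one mul0mx.
by rewrite !mxE => /eqP; rewrite oner_eq0.
Qed.

(** A colouring is a 0-cocycle, and its primitive is a single value on the empty set, which all
    vertices share. *)
Lemma exact_conn : exact_at 1 -> conn K.
Proof.
move=> ex col colE a b aK bK.
pose c (s : {set V}) : 'F_2 := [exists v in s, col v]%:R.
have c1 v : c [set v] = (col v)%:R.
  congr (nat_of_bool _)%:R; apply/exists_inP/idP => [[u /set1P->//]|vc].
  by exists v; rewrite ?set11.
have [t tK t2|d dP] := ex c.
  have /cards2P[x [y [xy tE]]] : #|t| == 2%N by rewrite t2.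
  have cxy : col x = col y by apply: colE; rewrite -tE.
  rewrite tE /scobd big_setU1 ?inE //= big_set1.
  have -> : [set x; y] :\ x = [set y] by rewrite setU1K // inE.
  have -> : [set x; y] :\ y = [set x] by rewrite setUC setU1K // inE eq_sym.
  by rewrite !c1 cxy addrr_F2.
have cE v : [set v] \in K -> (col v)%:R = d finset.set0.
  by move=> vK; rewrite -c1 -dP ?cards1 // /scobd big_set1 setDv.
have := cE a aK; rewrite -(cE b bK).
by case: (col a); case: (col b) => // /eqP; rewrite ?oner_eq0 // eq_sym oner_eq0.
Qed.

(** * The signed boundary of edges and the upper bound on the rank *)

Section Signed.
Variable R : numFieldType.

(** Up to a global sign, the coefficient of [v] in the boundary of the oriented edge [e]. *)
Definition vertex_sign (e : {set V}) (v : V) : R :=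
  if v \in e then (-1) ^+ (or e + #|[set u in e | (enum_rank u < enum_rank v)%N]|)%N else 0.

Definition edge_vertex_matrix : 'M[R]_(#|simplices K 1|, #|simplices K 0|) :=
  \matrix_(i, l) \sum_(v in (enum_val l : {set V})) vertex_sign (enum_val i) v.

Lemma signr_cancel m n : odd m = ~~ odd n -> (-1) ^+ m + (-1) ^+ n = 0 :> R.
Proof.
by rewrite -(signr_odd _ m) -(signr_odd _ n) => ->; case: (odd n); rewrite ?addrN ?addNr.
Qed.

Lemma enum_rank_ltC (u v : V) : u != v ->
  (enum_rank v < enum_rank u)%N = ~~ (enum_rank u < enum_rank v)%N.
Proof.
move=> uv; rewrite -leqNgt [RHS]leq_eqVlt orb_idl // => /eqP/val_inj/enum_rank_inj vu.
by rewrite vu eqxx in uv.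
Qed.

Lemma card_pair (P : pred V) a b : a != b -> #|[set u in [set a; b] | P u]| = (P a + P b)%N.
Proof.
move=> ab; rewrite -sum1dep_card big_mkcondr big_setU1 ?inE //= big_set1.
by case: (P a); case: (P b).
Qed.

(** The boundary of a boundary vanishes: a vertex of a triangle lies on two of its edges, which
    contribute opposite signs. *)
Lemma face_edge_vertex0 : face_edge_matrix R K or *m edge_vertex_matrix = 0.
Proof.
apply/matrixP => i l; rewrite !mxE.
have /simplicesP[fK f3] := enum_valP i; set f : {set V} := enum_val i in fK f3 *.
have /simplicesP[_ /eqP/cards1P[v vE]] := enum_valP l.
transitivity (\sum_(e in simplices K 1) incidence R or e f * vertex_sign e v).
  by rewrite [RHS]big_enum_val; apply: eq_bigr => j _; rewrite !mxE vE big_set1.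
have [vf|vf] := boolP (v \in f); last first.
  apply: big1 => e _; rewrite /incidence /vertex_sign.
  have [ef|_] := boolP (e \subset f); last by rewrite mul0r.
  by rewrite (negPf (contraNN (subsetP ef v) vf)) mulr0.
have /cards2P[a [b [ab fE]]] : #|f :\ v| == 2%N.
  by move: f3; rewrite (cardsD1 v) vf add1n => -[->].
have [av af] : a != v /\ a \in f by apply/andP; have := set21 a b; rewrite -fE !inE.
have [bv bf] : b != v /\ b \in f by apply/andP; have := set22 a b; rewrite -fE !inE.
have fE' : f = v |: [set a; b] by rewrite -fE setD1K.
have edge x : x != v -> x \in f -> [set v; x] \in simplices K 1.
  move=> xv xf; apply/simplicesP; rewrite cards2 eq_sym xv; split=> //.
  apply: (proj2 Kcx f) => //; last by apply/set0Pn; exists v; rewrite set21.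
  by apply/subsetP => y /set2P[]->.
have ne : [set v; b] != [set v; a].
  apply/eqP => /setP/(_ b); rewrite !inE eqxx orbT (negPf bv) /= eq_sym.
  by rewrite (negPf ab).
(* The contribution of the edge from [v] to [x], with [y] the remaining vertex: the position of [y]
   in [f] gives the incidence of the edge, that of [v] in the edge the sign of the vertex. *)
have term x y : x != v -> y != v -> x != y -> f = v |: [set x; y] ->
  incidence R or [set v; x] f * vertex_sign [set v; x] v =
  (-1) ^+ (or [set v; x] + or f + ((enum_rank v < enum_rank y) + (enum_rank x < enum_rank y)) +
    (or [set v; x] + (enum_rank x < enum_rank v)))%N.
  move=> xv yv xy fxy; rewrite /incidence /vertex_sign set21.
  have -> : [set v; x] \subset f.
    by rewrite fxy; apply/subsetP => z /set2P[]->; rewrite !inE eqxx ?orbT.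
  rewrite -exprD card_pair 1?eq_sym // ltnn add0n; congr (_ ^+ (_ + _ + _ + _)).
  rewrite /ref_incidence_exp.
  have -> : f :\: [set v; x] = [set y].
    apply/setP => z; rewrite fxy !inE; have [->|zv] /= := eqVneq z v.
      by rewrite eq_sym (negPf yv).
    by have [->|//] := eqVneq z x; rewrite (negPf xy).
  rewrite big_set1 fxy -sum1dep_card big_mkcondr.
  rewrite big_setU1 ?inE ?negb_or 1?eq_sym ?xv 1?eq_sym ?yv //=.
  rewrite big_setU1 ?inE //= big_set1 ltnn addn0.
  by case: (enum_rank v < _)%N; case: (enum_rank x < _)%N.
rewrite (bigD1 [set v; a]) ?edge //= (bigD1 [set v; b]) ?edge //= big1 => [|e].
  rewrite addr0 (term a b) // (term b a) //; last first.
  - by rewrite fE' [[set b; a]]setUC.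
  - by rewrite eq_sym.
  apply: signr_cancel; rewrite !oddD !oddb (enum_rank_ltC ab) (enum_rank_ltC av) (enum_rank_ltC bv).
  case: (or f); case: (or [set v; a]); case: (or [set v; b]);
  by case: (enum_rank a < enum_rank b)%N; case: (enum_rank a < _)%N; case: (enum_rank b < _)%N.
case/andP => /andP[/simplicesP[eK e2] ea] eb; rewrite /incidence /vertex_sign.
have [ef|_] := boolP (e \subset f); last by rewrite mul0r.
have [ve|_] := boolP (v \in e); last by rewrite mulr0.
have /cards1P[x xE] : #|e :\ v| == 1%N.
  by move: e2; rewrite (cardsD1 v) ve add1n => -[->].
have eE : e = [set v; x] by rewrite -(setD1K ve) xE.
have : x \in f :\ v.
  by have := set11 x; rewrite -xE !inE => /andP[-> /(subsetP ef)].
by rewrite fE => /set2P[] xe; move: ea eb; rewrite eE xe eqxx.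
Qed.

(** The kernel of the transpose consists of vertex functions with equal values at the ends of each
    edge; connectedness makes them constant, so its dimension is at most 1. *)
Lemma rank_edge_vertex_ge : conn K -> (#|simplices K 0| <= (\rank edge_vertex_matrix).+1)%N.
Proof.
move=> cK; rewrite -mxrank_tr -addn1 -leq_subLR -mxrank_ker.
apply: leq_trans (rank_leq_row (const_mx 1 : 'rV[R]_#|simplices K 0|)).
apply: mxrankS; apply/row_subP => i.
have := row_sub i (kermx edge_vertex_matrix^T).
move: (row i _) => y /sub_kermxP y0.
pose Y s := \sum_(l < #|simplices K 0|) y 0 l * (enum_val l == s)%:R.
have YE l : Y (enum_val l) = y 0 l.
  rewrite /Y (bigD1 l) //= eqxx mulr1 big1 ?addr0 // => k kl.
  by rewrite (inj_eq enum_val_inj) (negPf kl) mulr0.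
have Yedge a b : [set a; b] \in K -> Y [set a] = Y [set b].
  move=> abK; have [->//|ab] := eqVneq a b.
  have eS : [set a; b] \in simplices K 1 by apply/simplicesP; rewrite cards2 ab.
  have vS x : x \in [set a; b] -> [set x] \in simplices K 0.
    move=> xe; apply/simplicesP; rewrite cards1; split=> //.
    apply: (proj2 Kcx [set a; b]); rewrite ?sub1set //.
    by apply/set0Pn; exists x; rewrite set11.
  have /rowP/(_ (enum_rank_in eS [set a; b])) := y0; rewrite !mxE.
  under eq_bigr => l _ do rewrite !mxE enum_rankK_in // -YE.
  rewrite -(big_enum_val (fun s => Y s * \sum_(v in s) vertex_sign [set a; b] v)) /=.
  have ne : [set b] != [set a] by rewrite (inj_eq set1_inj) eq_sym.
  rewrite (bigD1 [set a]) ?vS ?set21 //= (bigD1 [set b]) ?vS ?set22 //= !big_set1 big1 => [|s].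
    rewrite addr0 /vertex_sign set21 set22 !card_pair // !ltnn add0n addn0.
    have z0 : (-1) ^+ (or [set a; b]) != 0 :> R by rewrite signr_eq0.
    rewrite (enum_rank_ltC ab) !exprD; move: z0; set z := (-1) ^+ _ => z0.
    move: (Y [set a]) (Y [set b]) => ya yb E.
    have /eqP : (ya - yb) * z = 0.
      by move: E; case: (_ < _)%N => /= E; [|rewrite -[RHS]oppr0]; rewrite -E; ring.
    by rewrite mulf_eq0 (negPf z0) orbF subr_eq0 => /eqP.
  case/andP => /andP[/simplicesP[_ /eqP/cards1P[x ->]] xa] xb.
  rewrite big_set1 /vertex_sign; case: ifP => [/set2P[] e|]; last by rewrite mulr0.
    by rewrite e eqxx in xa.
  by rewrite e eqxx in xb.
have [l0|n0] := pickP (fun l : 'I_#|simplices K 0| => true); last first.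
  by have -> : y = 0 by [apply/rowP => l; have := n0 l]; rewrite sub0mx.
move=> _; apply/submxP; exists (y 0 l0)%:M; rewrite mul_scalar_mx.
apply/rowP => l; rewrite !mxE mulr1 -!YE.
have /simplicesP[lK /eqP/cards1P[v vE]] := enum_valP l.
have /simplicesP[l0K /eqP/cards1P[v0 v0E]] := enum_valP l0.
rewrite vE v0E in lK l0K *.
have := cK (fun v => Y [set v] == Y [set v0]) _ v v0 lK l0K; rewrite eqxx => H.
by apply/eqP; apply: H => a b /Yedge ->.
Qed.

(** As the product of the two matrices is 0, their ranks add up to at most the number of edges. *)
Lemma rank_face_edge_le : conn K ->
  (\rank (face_edge_matrix R K or) + #|simplices K 0| <= #|simplices K 1|.+1)%N.
Proof.
move=> /rank_edge_vertex_ge h; apply: leq_trans (leq_add (leqnn _) h) _.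
by rewrite addnS ltnS mulmx0_rank_max // face_edge_vertex0.
Qed.

End Signed.
End Ranks.

(* Imported only here: its set notations would capture those of [finset] above. *)
From mathcomp Require Import all_classical all_reals all_analysis.
Import numFieldNormedType.Exports.
Local Open Scope classical_set_scope.
Local Open Scope ring_scope.

(** * Cohomology of a triangulated ball *)

Section SmallSimplices.
Variable R : realType.
Local Notation P := 'rV[R]_3.

Definition bary (xs : seq P) : P := (size xs)%:R^-1 *: \sum_(x <- xs) x.

(** Stands in for convexity: subdivision forms barycentres only. *)
Definition bary_closed (A : set P) :=
  forall xs, (0 < size xs)%N -> (forall x, x \in xs -> A x) -> A (bary xs).

Definition small (d : R) (xs : seq P) :=
  forall x y, x \in xs -> y \in xs -> `|x - y| <= d.

Lemma bary_sub (xs : seq P) z : (0 < size xs)%N ->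
  bary xs - z = (size xs)%:R^-1 *: \sum_(x <- xs) (x - z).
Proof.
move=> n0; rewrite sumrB scalerBr; congr (_ - _).
rewrite big_const_seq count_predT iter_addr_0 -(scaler_nat _ z) scalerA mulVf ?scale1r //.
by rewrite pnatr_eq0 -lt0n.
Qed.

Lemma bary_closed_ball z r : bary_closed [set y : P | `|z - y| <= r].
Proof.
move=> xs n0 H; rewrite /= distrC bary_sub // normrZ ger0_norm ?invr_ge0 ?ler0n //.
rewrite ler_pdivrMl ?ltr0n // (le_trans (ler_norm_sum _ _ _)) //.
rewrite mulrC mulr_natr -iter_addr_0 -count_predT -big_const_seq.
by rewrite !big_seq; apply: ler_sum => x /H /=; rewrite distrC.
Qed.

Lemma bary_closedI A B : bary_closed A -> bary_closed B -> bary_closed (A `&` B).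
Proof. by move=> hA hB xs n0 H; split; [apply: hA|apply: hB] => // x /H []. Qed.

(** [bary xs - x] is the average of [n] differences, one of them 0; this gives the factor
    [(n - 1) / n], at most [3 / 4]. *)
Lemma bary_dist (xs : seq P) d x : (size xs <= 4)%N -> small d xs -> x \in xs ->
  `|bary xs - x| <= 3 / 4 * d.
Proof.
move=> n4 sm xin.
have n0 : (0 < size xs)%N by case: (xs) xin.
have d0 : 0 <= d by apply: le_trans (sm x x xin xin); apply: normr_ge0.
rewrite bary_sub // normrZ ger0_norm ?invr_ge0 ?ler0n // ler_pdivrMl ?ltr0n //.
rewrite (perm_big _ (perm_to_rem xin)) /= big_cons subrr add0r.
apply: (@le_trans _ _ (d *+ (size xs).-1)).
  rewrite (le_trans (ler_norm_sum _ _ _)) // -(size_rem xin).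
  rewrite -iter_addr_0 -count_predT -big_const_seq.
  by rewrite !big_seq; apply: ler_sum => y /mem_rem yin; apply: sm.
rewrite -mulr_natr.
by move: n4 n0; case: (size xs) => [|[|[|[|[|n]]]]] //= _ _; lra.
Qed.

(** Every list on which subdivision evaluates [b] consists of barycentres of nested faces, so it
    stays in [A] and shrinks by the factor [3 / 4]. *)
Lemma sdn_local n (A : set P) xs d b b' : (n <= 4)%N -> size xs = n ->
  bary_closed A -> (forall x, x \in xs -> A x) -> small d xs ->
  (forall ys, size ys = n -> (forall y, y \in ys -> A y) -> small (3 / 4 * d) ys ->
     b ys = b' ys) ->
  sdn bary n b xs = sdn bary n b' xs.
Proof.
elim: n A xs b b' => [|n IH] A xs b b' n4 sxs cA xsA sm E.
  by apply: E; case: xs sxs {xsA sm}.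
apply: cobd_ext => zs; rewrite sxs /= => szs sub.
have bA : A (bary xs) by apply: cA; rewrite ?sxs.
(* Intersecting [A] with a ball keeps the vertices added later close to the present cone point. *)
apply: (IH (A `&` [set y | `|bary xs - y| <= 3 / 4 * d])) => //.
- exact: ltnW.
- by apply: bary_closedI => //; apply: bary_closed_ball.
- by move=> x /sub xin; split; [exact: xsA|apply: bary_dist; rewrite ?sxs].
- by move=> x y /sub ? /sub ?; apply: sm.
move=> ys sys ysA smys; apply: E; first by rewrite /= sys.
  by move=> y; rewrite inE => /orP[/eqP->//|/ysA[]].
have d0 : 0 <= 3 / 4 * d.
  have [x xin] : exists x, x \in xs.
    by case: (xs) sxs => [//|x ? _]; exists x; rewrite inE eqxx.
  by rewrite mulr_ge0 ?divr_ge0 //; apply: le_trans (normr_ge0 _) (sm x x xin xin).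
move=> x y; rewrite !inE => /orP[/eqP->|xin] /orP[/eqP->|yin].
- by rewrite subrr normr0.
- by case: (ysA _ yin).
- by rewrite distrC; case: (ysA _ xin).
- exact: smys.
Qed.

Lemma iter_sd_local N (A : set P) xs d b b' : (size xs <= 4)%N ->
  bary_closed A -> (forall x, x \in xs -> A x) -> small d xs ->
  (forall ys, size ys = size xs -> (forall y, y \in ys -> A y) ->
     small ((3 / 4) ^+ N * d) ys -> b ys = b' ys) ->
  iter N (sd bary) b xs = iter N (sd bary) b' xs.
Proof.
move=> n4 cA; elim: N xs d n4 => [|N IH] xs d n4 xsA sm E /=.
  by apply: E => //; rewrite expr0 mul1r.
apply: (sdn_local n4 (erefl _) cA xsA sm) => ys sys ysA smys.
apply: (IH _ (3 / 4 * d)) => //; first by rewrite sys.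
by move=> zs szs zsA smzs; apply: E; rewrite ?szs ?exprSr // -mulrA.
Qed.

End SmallSimplices.

(** * Compactness and uniform continuity *)

Lemma continuous_sum (R : numFieldType) (X : topologicalType) (W : normedModType R)
  (I : Type) (r : seq I) (f : I -> X -> W) :
  (forall i, continuous (f i)) -> continuous (fun x => \sum_(i <- r) f i x).
Proof.
move=> cf x; elim: r => [|i r IH].
  by under eq_fun do rewrite big_nil; apply: cvg_cst.
by under eq_fun do rewrite big_cons; apply: cvgD => //; exact: cf.
Qed.

Section Compactness.
Variable R : realType.
Local Notation P := 'rV[R]_3.

Lemma unit_ball_norm (x : P) : closed_unit_ball x -> `|x| <= 1.
Proof.
move=> xB; rewrite [`|x|]mx_normrE; apply/bigmax_leP; split => // -[i j] _ /=.
rewrite ord1 -(@expr_le1 _ 2) //; apply: le_trans xB.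
rewrite (bigD1 j) //= real_normK ?num_real // lerDl.
by apply: sumr_ge0 => k _; apply: sqr_ge0.
Qed.

Lemma compact_closed_unit_ball : compact (@closed_unit_ball R).
Proof.
apply: bounded_closed_compact.
  exists 1; split => // M M1 x /= xB; apply: le_trans (ltW M1).
  exact: unit_ball_norm.
have -> : @closed_unit_ball R =
    (fun x : P => \sum_i x ord0 i ^+ 2) @^-1` [set y | y <= 1] by [].
apply: closed_comp; last exact: closed_le.
move=> x _; apply: continuous_sum => i y.
have c := @coord_continuous R 1 3 ord0 i y; exact: (cvgM c c).
Qed.

Variable V : finType.

(** A hull is the continuous image of a set of weight vectors that is closed and bounded, hence
    compact. *)
Lemma closed_conv_hull (pos : V -> P) (s : {set V}) : closed (conv_hull pos s).
Proof.
pose W : set 'rV[R]_#|V| := [set w | (forall i, 0 <= w ord0 i) /\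
  ((forall i, enum_val i \notin s -> w ord0 i = 0) /\ \sum_i w ord0 i = 1)].
pose phi (w : 'rV[R]_#|V|) : P := \sum_i w ord0 i *: pos (enum_val i).
have sumE (U : nmodType) (G : 'I_#|V| -> U) : \sum_i G i = \sum_v G (enum_rank v).
  exact: reindex (onW_bij _ (@enum_rank_bij V)).
have -> : conv_hull pos s = phi @` W.
  apply/seteqP; split => [x [w [w0 ws w1 ->]]|x [w [w0 [ws w1]] <-]].
    exists (\row_i w (enum_val i)).
      split; first by move=> i; rewrite mxE.
      split; first by move=> i /ws; rewrite mxE.
      by rewrite sumE -w1; apply: eq_bigr => v _; rewrite mxE enum_rankK.
    by rewrite /phi sumE; apply: eq_bigr => v _; rewrite mxE enum_rankK.
  exists (fun v => w ord0 (enum_rank v)); split => //.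
  - by move=> v vs; apply: ws; rewrite enum_rankK.
  - by rewrite -w1 sumE.
  - by rewrite /phi sumE; apply: eq_bigr => v _; rewrite enum_rankK.
apply: compact_closed; first exact: norm_hausdorff.
have cphi : continuous phi.
  apply: continuous_sum => i y.
  apply: (@cvgZr_tmp R P _ (nbhs y) _ (fun w : 'rV[R]_#|V| => w ord0 i)).
  exact: (@coord_continuous R 1 #|V| ord0 i y).
apply: continuous_compact; first exact: continuous_subspaceT.
apply: bounded_closed_compact.
  exists 1; split => // M M1 w [w0 [ws w1]] /=; apply: le_trans (ltW M1).
  rewrite [`|w|]mx_normrE; apply/bigmax_leP; split => // -[i j] _ /=.
  rewrite ord1 ger0_norm // -w1 (bigD1 j) //= lerDl.
  by apply: sumr_ge0.
have -> : W = (\bigcap_(i : 'I_#|V|) ((fun w : 'rV[R]_#|V| => w ord0 i) @^-1` [set y | 0 <= y]))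
  `&` (\bigcap_(i in [set i | enum_val i \notin s])
       ((fun w : 'rV[R]_#|V| => w ord0 i) @^-1` [set y | y = 0]))
  `&` ((fun w : 'rV[R]_#|V| => \sum_i w ord0 i) @^-1` [set y | y = 1]).
  apply/seteqP; split => [w [w0 [ws w1]]|w [[w0 ws] w1]].
    by split => //; split => [i _|i /ws]; rewrite /preimage /=.
  by split; [move=> i; exact: w0|split].
have cl1 (a : R) : closed [set y | y = a] by apply: closed_eq.
apply: closedI; first apply: closedI.
- apply: closed_bigI => i _; apply: closed_comp; last exact: closed_ge.
  by move=> w _; exact: coord_continuous.
- apply: closed_bigI => i _; apply: closed_comp => //.
  by move=> w _; exact: coord_continuous.
- apply: closed_comp => // w _; apply: continuous_sum => i.
  exact: (@coord_continuous R 1 #|V| ord0 i).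
Qed.

(** The Heine-Cantor theorem: near each point of [A] one radius serves all nearby points, and
    compactness merges the local radii. *)
Lemma compact_unif_continuous (A : set P) (f : P -> P) (e : R) :
  compact A -> {within A, continuous f} -> 0 < e ->
  exists2 d : R, 0 < d & forall x y, A x -> A y -> `|x - y| <= d -> `|f x - f y| <= e.
Proof.
move=> /compact_near_coveringP/near_covering_withinP cA cf e0.
have e20 : 0 < e / 2 by rewrite divr_gt0.
have : \forall d \near 0^'+, A `<=` [set x | forall y, A y -> `|x - y| <= d -> `|f x - f y| <= e].
  apply: cA => x Ax.
  have := (iffLR (subspace_continuousP _ _) cf) x Ax.
  move=> /cvgrPdist_lt /(_ _ e20) fx.
  have [r /= r0 H] : exists2 r : R, 0 < r & forall y, `|x - y| < r -> A y -> `|f x - f y| < e / 2.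
    move: fx; rewrite near_withinE => /nbhs_ballP[r /= r0 H]; exists r => // y xy Ay.
    by apply: H => //; rewrite -ball_normE.
  have r20 : 0 < r / 2 by rewrite divr_gt0.
  near=> x' d => Ax' y Ay xy /=.
  have xx' : `|x - x'| < r / 2.
    by near: x'; apply/nbhs_ballP; exists (r / 2) => //= z; rewrite -ball_normE.
  have d2 : d < r / 2 by near: d; apply: nbhs_right_lt.
  have h1 : `|f x - f x'| < e / 2.
    by apply: H => //; rewrite (lt_le_trans xx') // ler_pdivrMr // ler_peMr ?ltW // ler1n.
  have h2 : `|f x - f y| < e / 2.
    apply: H => //; rewrite (le_lt_trans (ler_distD x' _ _)) // (splitr r) ltrD //.
    exact: le_lt_trans xy d2.
  by rewrite (le_trans (ler_distD (f x) _ _)) // (distrC (f x')) (splitr e) lerD // ltW.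
move=> H; near ((0 : R)^'+) => d; exists d; first by near: d; exact: nbhs_right_gt.
by move=> x y Ax Ay; apply: (near H d).
Unshelve. all: by end_near. Qed.

End Compactness.

Section Hulls.
Variables (R : realType) (V : finType) (pos : V -> 'rV[R]_3).
Local Notation P := 'rV[R]_3.

Lemma conv_hull0 x : ~ conv_hull pos finset.set0 x.
Proof.
case=> w [_ w0 w1 _]; have : \sum_v w v = 0 by apply: big1 => v _; rewrite w0 ?inE.
by rewrite w1 => /eqP; rewrite oner_eq0.
Qed.

Lemma conv_hull_vertex (s : {set V}) v : v \in s -> conv_hull pos s (pos v).
Proof.
move=> vs; exists (fun u => (u == v)%:R); split.
- by move=> u; rewrite ler0n.
- by move=> u; case: eqP => // ->; rewrite vs.
- by rewrite (bigD1 v) //= eqxx big1 ?addr0 // => u /negPf->.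
- rewrite (bigD1 v) //= eqxx scale1r big1 ?addr0 // => u /negPf->.
  by rewrite scale0r.
Qed.

Lemma bary_closed_conv_hull (s : {set V}) : bary_closed (conv_hull pos s).
Proof.
move=> xs n0 H.
have nz : (size xs)%:R != 0 :> R by rewrite pnatr_eq0 -lt0n.
suff [w [w0 ws w1 wx]] : exists w : V -> R, [/\ forall v, 0 <= w v,
    forall v, v \notin s -> w v = 0, \sum_v w v = (size xs)%:R &
    \sum_(x <- xs) x = \sum_v w v *: pos v].
  exists (fun v => (size xs)%:R^-1 * w v); split.
  - by move=> v; rewrite mulr_ge0 ?invr_ge0 ?ler0n.
  - by move=> v /ws ->; rewrite mulr0.
  - by rewrite -mulr_sumr w1 mulVf.
  - by rewrite /bary wx scaler_sumr; apply: eq_bigr => v _; rewrite scalerA.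
elim: xs H {n0 nz} => [|x xs IH] H.
  exists (fun=> 0); split => //; first by rewrite big1.
  by rewrite big_nil big1 // => v _; rewrite scale0r.
have [|w [w0 ws w1 wx]] := IH; first by move=> y yin; apply: H; rewrite inE yin orbT.
have [u [u0 us u1 ux]] := H x (mem_head _ _).
exists (fun v => u v + w v); split.
- by move=> v; rewrite addr_ge0.
- by move=> v vs; rewrite us // ws // addr0.
- by rewrite big_split /= u1 w1 -natr1 addrC.
- by rewrite big_cons wx {1}ux -big_split; apply: eq_bigr => v _; rewrite scalerDl.
Qed.

Lemma posB_le u v : `|pos u - pos v| <= \sum_a \sum_b `|pos a - pos b|.
Proof.
rewrite (bigD1 u) //= (bigD1 v) //= -addrA lerDl addr_ge0 ?sumr_ge0 // => a _.
exact: sumr_ge0.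
Qed.

End Hulls.

(** * Labelling points by vertices, and Sperner's lemma *)

Section Labelling.
Variables (R : realType) (V : finType) (K : {set {set V}}) (pos : V -> 'rV[R]_3).
Local Notation P := 'rV[R]_3.
Hypothesis Kcx : is_simplicial_complex K.
Hypothesis Kgeo : geometric_realization pos K.

(** Any vertex of a smallest simplex [s] containing [x] will do: [x] lies in the common face
    [s :&: t], which minimality makes equal to [s]. *)
Lemma carrier_vertex x : polyhedron pos K x ->
  exists v, forall t, t \in K -> conv_hull pos t x -> v \in t.
Proof.
case: Kcx => K0 Kdown [s0 s0K s0x].
pose p (s : {set V}) := (s \in K) && `[< conv_hull pos s x >].
have p0 : p s0 by rewrite /p s0K; apply/asboolP.
case: (@arg_minnP _ s0 p (fun s => #|s|) p0) => s /andP[sK /asboolP sx] smin.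
have /set0Pn[v vs] : s != finset.set0 by apply: contraNneq K0 => <-.
exists v => t tK tx.
have ix : conv_hull pos (s :&: t) x by rewrite -(proj2 Kgeo).
have iK : s :&: t \in K.
  apply: (Kdown s) => //; first exact: subsetIl.
  by apply: contraPneq ix => ->; apply: conv_hull0.
have /smin le : p (s :&: t) by rewrite /p iK; apply/asboolP.
have /eqP e : s :&: t == s by rewrite eqEcard subsetIl le.
by move: vs; rewrite -e inE => /andP[].
Qed.

(** A Lebesgue number argument: a point is labelled by a vertex such that all simplices missing it
    are farther away than [e]. The labels of a small list then lie in any simplex that contains its
    first point. *)
Lemma labelling (v0 : V) : compact (polyhedron pos K) ->
  exists (e : R) (lab : P -> V), [/\ 0 < e,
    forall s x, s \in K -> conv_hull pos s x -> lab x \in s &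
    forall xs, (0 < size xs)%N -> (forall x, x \in xs -> polyhedron pos K x) ->
      small e xs -> [set:: map lab xs] \in K].
Proof.
move=> /compact_near_coveringP cK.
have : \forall d \near (0 : R)^'+, polyhedron pos K `<=` [set x | exists v,
    forall s y, s \in K -> v \notin s -> conv_hull pos s y -> ~ `|x - y| <= d].
  apply: cK => x /carrier_vertex[v vP].
  pose Xv := \bigcup_(s in [set s | (s \in K) && (v \notin s)]) conv_hull pos s.
  have cXv : closed Xv.
    by apply: closed_bigcup => [|s _]; [exact: finite_finset|exact: closed_conv_hull].
  have xXv : ~ Xv x by case=> s /= /andP[sK vs] /(vP _ sK); apply/negP.
  have : nbhs x (~` Xv) by apply: open_nbhs_nbhs; split => //; apply: closed_openC.
  move=> /nbhs_ballP[r /= r0 H].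
  have r20 : 0 < r / 2 by rewrite divr_gt0.
  near=> x' d => /=; exists v => s y sK vs sy x'y.
  have xx' : `|x - x'| < r / 2.
    by near: x'; apply/nbhs_ballP; exists (r / 2) => //= z; rewrite -ball_normE.
  have d2 : d < r / 2 by near: d; apply: nbhs_right_lt.
  apply: (H y); last by exists s => //=; rewrite sK.
  rewrite -ball_normE /= (le_lt_trans (ler_distD x' _ _)) // (splitr r) ltrD //.
  exact: le_lt_trans x'y d2.
move=> H; near ((0 : R)^'+) => d.
have Hd : polyhedron pos K `<=` [set x | exists v,
    forall s y, s \in K -> v \notin s -> conv_hull pos s y -> ~ `|x - y| <= d].
  by near: d.
have {}Hd x : exists v, polyhedron pos K x -> forall s y, s \in K -> v \notin s ->
    conv_hull pos s y -> ~ `|x - y| <= d.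
  have [Kx|nKx] := pselect (polyhedron pos K x); last by exists v0.
  by have [v vP] := Hd x Kx; exists v.
have [lab labP] := choice Hd.
have d0 : 0 < d by near: d; exact: nbhs_right_gt.
exists d, lab; split => //.
  move=> s x sK sx; apply/negPn/negP => ls.
  have Kx : polyhedron pos K x by exists s.
  by apply: (labP x Kx s x sK ls sx); rewrite subrr normr0 ltW.
case=> // x xs _ xsK sm; have [s sK sx] := xsK x (mem_head _ _).
apply: (proj2 Kcx s) => //.
  apply/fintype.subsetP => v; rewrite inE => /mapP[y yin ->].
  apply/negPn/negP => ls; apply: (labP y (xsK y yin) s x sK ls sx).
  by apply: sm => //; exact: mem_head.
by apply/set0Pn; exists (lab x); rewrite inE mem_head.
Unshelve. all: by end_near. Qed.

(* Sperner's lemma: subdividing and relabelling is the identity on cochains,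
   because it commutes with coboundaries and preserves dimension *)
Lemma sperner N (lab : P -> V) (s : {set V}) (c : {set V} -> 'F_2) :
  (forall s x, s \in K -> conv_hull pos s x -> lab x \in s) ->
  s \in K \/ s = finset.set0 -> (#|s| <= 4)%N ->
  iter N (sd (@bary R)) (fun ys => lcochain c (map lab ys)) (map pos (enum s)) = c s.
Proof.
move=> labP; move: {2}#|s| (erefl #|s|) => n; elim: n s c => [|n IH] s c sn sK s4.
  move/eqP: sn; rewrite cards_eq0 => /eqP ->.
  by rewrite enum_set0 iter_sd_nil /lcochain /= finset.set_nil.
have /set0Pn[v0 v0s] : s != finset.set0 by rewrite -card_gt0 sn.
have {}sK : s \in K by case: sK => // s0; rewrite s0 cards0 in sn.
(* [b] lives on the face opposite [v0] alone, so its coboundary takes the value [c s] on [s]. *)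
pose b t := if t == s :\ v0 then c s else 0.
have bs : scobd b s = c s.
  rewrite /scobd (bigD1 v0) //= {1}/b eqxx big1 ?addr0 // => v /andP[vs vv0].
  rewrite /b; case: eqP => // /setP/(_ v0); rewrite !inE eqxx v0s andbT.
  by rewrite eq_sym vv0.
(* On lists in the hull of [s] with as many points as [s] has vertices, distinct labels exhaust [s],
   so [c] may be replaced by the coboundary of [b]. This passes to the faces of [s]. *)
transitivity (iter N (sd (@bary R)) (cobd (fun ys => lcochain b (map lab ys)))
    (map pos (enum s))).
  apply: (@iter_sd_local _ _ (conv_hull pos s) _ (\sum_a \sum_b `|pos a - pos b|)).
  - by rewrite size_map -cardE.
  - exact: bary_closed_conv_hull.
  - by move=> x /mapP[v + ->]; rewrite mem_enum; apply: conv_hull_vertex.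
  - by move=> x y /mapP[u _ ->] /mapP[v _ ->]; apply: posB_le.
  move=> ys; rewrite size_map -cardE => sys ysP _.
  rewrite (cobd_comp_map lab (lcochain b)) cobd_lcochain /lcochain.
  case: ifP => // u; suff -> : [set:: map lab ys] = s by [].
  apply/eqP; rewrite eqEcard; apply/andP; split.
    by apply/fintype.subsetP => v; rewrite inE => /mapP[y /ysP yP ->]; apply: labP yP.
  by rewrite cardsE (card_uniqP u) size_map sys.
rewrite iter_sd_cobd -(cobd_comp_map pos) cobd_enum -bs; apply: eq_bigr => v vs.
have sv : #|s :\ v| = n by move: sn; rewrite (cardsD1 v) vs => -[].
apply: IH => //.
  have [->|ne] := eqVneq (s :\ v) finset.set0; first by right.
  by left; apply: (proj2 Kcx s) => //; apply: subD1set.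
by rewrite sv; apply: ltnW; rewrite -sn.
Qed.

End Labelling.

(** * Contracting the ball and pulling back to the complex *)

Section BallContraction.
Variable R : realType.
Local Notation P := 'rV[R]_3.

(** The prisms over the [N] steps of the contraction telescope. Two points of a prism differ by at
    most [e / 2] along the list and [e / 2] along the step, so the coboundary of [a] vanishes
    there. *)
Lemma ball_primitive (a : seq P -> 'F_2) m (e : R) : 0 < e -> (0 < m)%N ->
  (forall ys, size ys = m.+1 -> (forall y, y \in ys -> closed_unit_ball y) ->
     small e ys -> cobd a ys = 0) ->
  ((1 < m)%N -> a (nseq m 0) = 0) ->
  exists b, forall xs, size xs = m -> (forall x, x \in xs -> closed_unit_ball x) ->
     small (e / 2) xs -> cobd b xs = a xs.
Proof.
move=> e0 m0 ca a0.
have e20 : 0 < e / 2 by rewrite divr_gt0.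
have [N N0 Ne] : exists2 N : nat, (0 < N)%N & N%:R^-1 <= e / 2 :> R.
  exists (Num.truncn (e / 2)^-1).+1 => //.
  rewrite -[leRHS]invrK lef_pV2 ?posrE ?invr_gt0 ?ltr0n //.
  by apply/ltW/truncnS_gt.
pose f (j : nat) (x : P) := (j%:R / N%:R) *: x.
(* For [m = 1] the end term [a [:: 0]] remains; it is the coboundary of the cochain with this value
   on the empty list. *)
pose k (ys : seq P) := if nilp ys then a [:: 0] else 0.
exists (fun ys => \sum_(j < N) prism (f j) (f j.+1) a ys + k ys) => xs sxs xsB sm.
rewrite cobdD cobd_sum.
have N0r : 0 < N%:R :> R by rewrite ltr0n.
have fB (j : nat) x : (j <= N)%N -> closed_unit_ball x -> closed_unit_ball (f j x).
  move=> jN xB; rewrite /closed_unit_ball /=.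
  under eq_bigr do rewrite mxE exprMn.
  rewrite -mulr_sumr mulr_ile1 ?sqr_ge0 ?exprn_ge0 ?divr_ge0 ?ler0n //.
    by apply: sumr_ge0 => i _; apply: sqr_ge0.
  by rewrite expr_le1 ?divr_ge0 ?ler0n // ler_pdivrMr // mul1r ler_nat.
have f1 (j : nat) x y : (j <= N)%N -> `|f j x - f j y| <= `|x - y|.
  move=> jN; rewrite /f -scalerBr normrZ ger0_norm ?divr_ge0 ?ler0n //.
  by rewrite ler_piMl // ler_pdivrMr // mul1r ler_nat.
have f2 (j : nat) x : closed_unit_ball x -> `|f j x - f j.+1 x| <= e / 2.
  move=> /unit_ball_norm x1; rewrite /f -scalerBl normrZ distrC -mulrBl normrM.
  have -> : `|j.+1%:R - j%:R| = 1 :> R by rewrite -natr1 addrAC subrr add0r normr1.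
  rewrite mul1r ger0_norm ?invr_ge0 ?ler0n //.
  by apply: le_trans Ne; rewrite ler_piMr ?invr_ge0 ?ler0n.
have step (j : 'I_N) : cobd (prism (f j) (f j.+1) a) xs =
    a (map (f j) xs) + a (map (f j.+1) xs).
  rewrite -cobd_prism [X in _ = _ + X]prism_eq0 ?addr0 // => ys.
  rewrite sxs => sys ysP; apply: ca => //.
    by move=> y /ysP[x xin [] ->]; apply: fB (xsB _ xin) => //; exact: ltnW.
  have mix x y : x \in xs -> y \in xs -> `|f j x - f j.+1 y| <= e.
    move=> xin yin; rewrite (le_trans (ler_distD (f j y) _ _)) // (splitr e) lerD //.
      by apply: (le_trans (f1 _ _ _ _)); [exact: ltnW|exact: sm].
    by apply: f2; apply: xsB.
  have e2e : e / 2 <= e by rewrite ler_pdivrMr // ler_peMr ?ltW // ltr1n.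
  move=> y z /ysP[x xin [] ->] /ysP[x' xin' [] ->].
  - by apply: (le_trans (f1 _ _ _ _)); [exact: ltnW|apply: le_trans e2e; exact: sm].
  - exact: mix.
  - by rewrite distrC; apply: mix.
  - by apply: (le_trans (f1 _ _ _ _)); [|apply: le_trans e2e; exact: sm].
rewrite (eq_bigr _ (fun j _ => step j)).
have -> : \sum_(j < N) (a (map (f j) xs) + a (map (f j.+1) xs)) =
    a (map (f 0%N) xs) + a (map (f N) xs).
  elim: (N) => [|n IH]; first by rewrite big_ord0 addrr_F2.
  rewrite big_ord_recr IH /= -addrA [X in _ + X]addrA addrr_F2 add0r.
  by [].
have -> : map (f N) xs = xs.
  by rewrite -[RHS]map_id; apply: eq_map => x; rewrite /f divff ?scale1r ?gt_eqF.
have -> : map (f 0%N) xs = nseq m 0.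
  rewrite -sxs; elim: (xs) => //= x ys ->.
  by rewrite /f mul0r scale0r.
have -> : cobd k xs = a (nseq m 0).
  case: m m0 a0 sxs {ca} => [//|[|m]] _ a0; case: xs {xsB sm step} => // x [|y xs] // _.
    by rewrite /= addr0.
  rewrite a0 // [LHS]/= /k /= cobd0 !addr0.
  by case: xs.
by rewrite addrAC addrr_F2 add0r.
Qed.

End BallContraction.

Lemma ball_cohomology0 (R : realType) (V : finType) (K : {set {set V}})
    (pos : V -> 'rV[R]_3) (m : nat) (c : {set V} -> 'F_2) (v0 : V) :
  is_simplicial_complex K -> geometric_realization pos K ->
  homeomorphic (polyhedron pos K) (@closed_unit_ball R) ->
  (0 < m <= 4)%N -> (forall t, t \in K -> #|t| = m.+1 -> scobd c t = 0) ->
  exists b, forall s, s \in K -> #|s| = m -> scobd b s = c s.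
Proof.
move=> Kcx Kgeo [f [g [[fX gB] gf fg cf cg]]] /andP[m0 m4] cc.
set X := polyhedron pos K in fX gB gf cf.
have cB := @compact_closed_unit_ball R.
have cX : compact X.
  have -> : X = g @` (@closed_unit_ball R).
    apply/seteqP; split => [x Xx|]; last exact: gB.
    by exists (f x); [apply: fX; exists x|apply: gf].
  exact: continuous_compact.
have [e [lab [e0 lab1 lab2]]] := labelling Kcx Kgeo v0 cX.
have [eta eta0 geta] := compact_unif_continuous cB cg e0.
(* [c] transported to the ball: a point is labelled through its image in the complex. *)
pose a ys := lcochain c (map (lab \o g) ys).
have [b bP] : exists b, forall xs, size xs = m ->
    (forall x, x \in xs -> closed_unit_ball x) -> small (eta / 2) xs -> cobd b xs = a xs.
  apply: ball_primitive => //.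
    move=> ys sys ysB sm; rewrite /a (cobd_comp_map (lab \o g)) cobd_lcochain /lcochain.
    case: ifP => // u; apply: cc; last by rewrite cardsE (card_uniqP u) size_map.
    rewrite map_comp; apply: lab2; first by rewrite size_map sys.
      by move=> x /mapP[y /ysB yB ->]; apply: gB; exists y.
    move=> x x' /mapP[y yin ->] /mapP[y' yin' ->].
    by apply: geta; [exact: ysB|exact: ysB|exact: sm].
  case: (m) => [|[|n]] // _; rewrite /a /lcochain /= !inE eqxx //.
have eta20 : 0 < eta / 2 by rewrite divr_gt0.
have [z z0 fz] := compact_unif_continuous cX cf eta20.
pose D := \sum_a \sum_b `|pos a - pos b|.
(* After [N] subdivisions all lists are so small that [f] maps them into the range where [b] is a
   primitive of [a]. *)
have [N ND] : exists N : nat, (3 / 4) ^+ N * D <= z.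
  have D0 : 0 < D + 1 by rewrite ltr_wpDl //; do 2!apply: sumr_ge0 => ? _.
  have : (fun n => (3 / 4 : R) ^+ n) @ \oo --> (0 : R).
    by apply: cvg_expr; rewrite ger0_norm ?divr_ge0 //; lra.
  move=> /cvgrPdist_lt /(_ (z / (D + 1)) (divr_gt0 z0 D0)) [N _ /(_ N (leqnn N))] /=.
  rewrite sub0r normrN ger0_norm ?exprn_ge0 ?divr_ge0 // ltr_pdivlMr // => h.
  exists N; apply: ltW; apply: le_lt_trans h; rewrite ler_wpM2l ?exprn_ge0 ?divr_ge0 //.
  by rewrite lerDl.
pose gam xs := b (map f xs).
exists (fun s : {set V} => iter N (sd (@bary R)) gam (map pos (enum s))) => s sK sm.
rewrite /scobd -(cobd_enum (fun vs => iter N (sd (@bary R)) gam (map pos vs))).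
rewrite (cobd_comp_map pos) -iter_sd_cobd.
rewrite -(@sperner _ _ _ _ Kcx N _ _ _ lab1 (or_introl sK)) ?sm //.
apply: (@iter_sd_local _ _ (conv_hull pos s) _ D).
- by rewrite size_map -cardE sm.
- exact: bary_closed_conv_hull.
- by move=> x /mapP[v + ->]; rewrite mem_enum; apply: conv_hull_vertex.
- by move=> x y /mapP[u _ ->] /mapP[v _ ->]; apply: posB_le.
move=> ys; rewrite size_map -cardE sm => sys ysP smys.
have ysX y : y \in ys -> X y by move=> /ysP yP; exists s.
rewrite /gam (cobd_comp_map f) bP ?size_map //.
- rewrite /a -map_comp; congr lcochain; apply/eq_in_map => y /ysX yX /=.
  by rewrite gf.
- by move=> x /mapP[y /ysX yX ->]; apply: fX; exists y.
- move=> x x' /mapP[y yin ->] /mapP[y' yin' ->]; apply: fz; [exact: ysX|exact: ysX|].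
  by apply: le_trans ND; apply: smys.
Qed.

(** * Tetrahedra around a triangle *)

Section TetrahedraAtTriangle.
Variables (R : realType) (V : finType) (K : {set {set V}}) (pos : V -> 'rV[R]_3).
Hypothesis Kgeo : geometric_realization pos K.

Definition affine_dep (w : V -> R) := \sum_v w v = 0 /\ \sum_v w v *: pos v = 0.

(** Coefficients of opposite sign at [x] and [y] mean that both apexes lie on one side of the plane
    of [f]. A point [p] slightly off the centroid of [f] towards [y] then lies in both tetrahedra
    but not in [f]. *)
Lemma apexes_opposite (f : {set V}) x y (w : V -> R) : #|f| = 3%N ->
  x \notin f -> y \notin f -> x != y -> x |: f \in K -> y |: f \in K ->
  (forall v, v \notin x |: (y |: f) -> w v = 0) -> affine_dep w ->
  0 < w x -> w y < 0 -> False.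
Proof.
move=> f3 xf yf xy xK yK ws [w1 wp] wx wy.
pose b := - w y; have b0 : 0 < b by rewrite oppr_gt0.
pose S := \sum_v `|w v|; have S0 : 0 <= S by apply: sumr_ge0.
have wS v : `|w v| <= S by rewrite /S (bigD1 v) //= lerDl sumr_ge0.
(* This makes the weight [(1 - e * b) / 3] of each vertex of [f] equal to [e * S], enough to absorb
   [e * w v]. *)
pose e := (b + 3 * S)^-1.
have eS : e * (b + 3 * S) = 1 by rewrite mulVf // gt_eqF // ltr_wpDr // mulr_ge0.
have e0 : 0 < e by rewrite invr_gt0 ltr_wpDr // mulr_ge0.
pose g v : R := (v \in f)%:R / 3.
have g1 : \sum_v g v = 1.
  by rewrite -mulr_suml -natr_sum -big_mkcond sum1_card f3 divff.
(* [u2] gives the weights of [p] in the tetrahedron at [y]; adding [e * w] removes [y] and brings in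
   [x] without moving the point. *)
pose u2 v := (1 - e * b) * g v + e * b * (v == y)%:R.
pose u1 v := u2 v + e * w v.
have u2_1 : \sum_v u2 v = 1.
  rewrite big_split /= -!mulr_sumr g1 (bigD1 y) //= eqxx big1 => [|v /negPf->//].
  by rewrite addr0 !mulr1 subrK.
have u1_1 : \sum_v u1 v = 1 by rewrite big_split /= u2_1 -mulr_sumr w1 mulr0 addr0.
have u12 : \sum_v u1 v *: pos v = \sum_v u2 v *: pos v.
  under eq_bigr do rewrite scalerDl -scalerA.
  by rewrite big_split /= -scaler_sumr wp scaler0 addr0.
have eb1 : 0 <= 1 - e * b.
  by rewrite -eS mulrDr addrAC subrr add0r !mulr_ge0 // ltW.
have g0 v : 0 <= g v by rewrite divr_ge0.
set p := \sum_v u2 v *: pos v.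
have u20 v : 0 <= u2 v.
  by rewrite /u2 addr_ge0 // mulr_ge0 // mulr_ge0 // ltW.
have p2 : conv_hull pos (y |: f) p.
  exists u2; split => // v.
  by rewrite !inE negb_or => /andP[/negPf vy /negPf vf]; rewrite /u2 /g vy vf mul0r !mulr0 addr0.
have p1 : conv_hull pos (x |: f) p.
  exists u1; split => // v.
    have [->|vy] := eqVneq v y.
      have -> : u1 y = (1 - e * b) * g y by rewrite /u1 /u2 eqxx /= /b; ring.
      by rewrite mulr_ge0.
    have [->|vx] := eqVneq v x.
      by rewrite /u1 addr_ge0 // mulr_ge0 // ltW.
    have [vf|vf] := boolP (v \in f); last first.
      by rewrite /u1 /u2 ws ?inE ?negb_or ?vx ?vy // /g (negPf vf) (negPf vy) mul0r !mulr0 !addr0.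
    rewrite /u1 /u2 /g vf (negPf vy) mulr0 addr0.
    have h : 1 - e * b = 3 * (e * S) by rewrite -{1}eS; ring.
    have -> : (1 - e * b) * (true%:R / 3) = e * S by rewrite h /=; field.
    rewrite -mulrDr; apply: mulr_ge0; first exact: ltW.
    by rewrite -lerBlDl sub0r lerNnormlW.
  rewrite !inE negb_or => /andP[vx vf]; have [->|vy] := eqVneq v y.
    by rewrite /u1 /u2 /g (negPf yf) eqxx /= /b; ring.
  by rewrite /u1 /u2 ws ?inE ?negb_or ?vx ?vy // /g (negPf vf) (negPf vy) mul0r !mulr0 !addr0.
have : conv_hull pos ((x |: f) :&: (y |: f)) p by rewrite -(proj2 Kgeo).
have -> : (x |: f) :&: (y |: f) = f.
  apply/setP => v; rewrite !inE; have [->|] //= := eqVneq v x.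
    by rewrite (negPf xy) (negPf xf).
  by rewrite andb_idr // => ->; rewrite orbT.
case=> u3 [_ u3s u3_1 u3p].
have := proj1 Kgeo _ yK (fun v => u2 v - u3 v) _ _ _ y.
rewrite /u2 eqxx /g (negPf yf) u3s // mul0r mulr0 add0r mulr1 subr0.
have ne : e * b <> 0 by apply/eqP; rewrite mulf_neq0 ?gt_eqF.
move=> H; apply: ne; apply: H.
- move=> v; rewrite !inE negb_or => /andP[/negPf vy vf]; rewrite u3s // vy (negPf vf).
  by rewrite mul0r !mulr0 addr0 subr0.
- by rewrite sumrB u3_1 u2_1 subrr.
- under eq_bigr do rewrite scalerBl.
  by rewrite sumrB -u3p subrr.
Qed.

(** In homogeneous coordinates the points are vectors in dimension 4, and more than four of them are
    linearly dependent. *)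
Lemma affine_dep_ex (S : {set V}) : (4 < #|S|)%N -> exists w : V -> R,
  [/\ forall v, v \notin S -> w v = 0, affine_dep w & exists v, w v != 0].
Proof.
move=> S4.
pose A : 'M[R]_(#|S|, 3 + 1) := \matrix_i row_mx (pos (enum_val i)) (const_mx 1).
have /eqP : \rank (kermx A) <> 0%N.
  by rewrite mxrank_ker; have := rank_leq_col A; move: S4; clear; lia.
rewrite mxrank_eq0 => /rowV0Pn[k /sub_kermxP kA k0].
have {}kA : \sum_i k 0 i *: row_mx (pos (enum_val i)) (const_mx 1) = 0 :> 'rV[R]_(3 + 1).
  by rewrite -[RHS]kA mulmx_sum_row; apply: eq_bigr => i _; rewrite rowK.
pose w v := \sum_i k 0 i * (enum_val i == v)%:R.
have sumw (U : lmodType R) (F : V -> U) : \sum_v w v *: F v = \sum_i k 0 i *: F (enum_val i).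
  under eq_bigr do rewrite scaler_suml.
  rewrite exchange_big /=; apply: eq_bigr => i _.
  rewrite (bigD1 (enum_val i)) //= eqxx mulr1 big1 ?addr0 // => v vi.
  by rewrite eq_sym (negPf vi) mulr0 scale0r.
have wE i : w (enum_val i) = k 0 i.
  rewrite /w (bigD1 i) //= eqxx mulr1 big1 ?addr0 // => j ji.
  by rewrite (inj_eq enum_val_inj) (negPf ji) mulr0.
exists w; split.
- move=> v vS; rewrite /w big1 // => i _; case: eqP => [e|]; last by rewrite mulr0.
  by rewrite -e enum_valP in vS.
- split.
    transitivity (\sum_v w v *: (1 : R^o)).
      by apply: eq_bigr => v _; rewrite /GRing.scale /= mulr1.
    rewrite sumw; move/(congr1 rsubmx): kA; rewrite linear_sum linear0 => /matrixP/(_ 0 0).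
    rewrite summxE mxE => {}kA; rewrite -[RHS]kA; apply: eq_bigr => i _.
    by rewrite linearZ /= row_mxKr !mxE.
  rewrite sumw; move/(congr1 lsubmx): kA; rewrite linear_sum linear0 => {}kA; rewrite -[RHS]kA.
  by apply: eq_bigr => i _; rewrite linearZ /= row_mxKl.
- by case/rV0Pn: k0 => i ki; exists (enum_val i); rewrite wE.
Qed.

(** A dependency of the five points involves [x] and [y], since either tetrahedron alone is affinely
    independent. Scaling gives 1 at [x], and [apexes_opposite] excludes a negative value at [y]. *)
Lemma apexes_same_sign (f : {set V}) x y : #|f| = 3%N ->
  x \notin f -> y \notin f -> x != y -> x |: f \in K -> y |: f \in K ->
  exists w : V -> R, [/\ forall v, v \notin x |: (y |: f) -> w v = 0,
    affine_dep w, w x = 1 & 0 < w y].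
Proof.
move=> f3 xf yf xy xK yK.
have xyf : x \notin y |: f by rewrite !inE negb_or xy.
have [|w [ws [w1 wp] [v0 wv0]]] := @affine_dep_ex (x |: (y |: f)).
  by rewrite !cardsU1 xyf yf f3.
have wx : w x != 0.
  apply: contraNneq wv0 => wx; apply/eqP; apply: (proj1 Kgeo _ yK w) => // v vyf.
  by have [->//|vx] := eqVneq v x; apply: ws; rewrite inE negb_or inE vx.
have wy : w y != 0.
  apply: contraNneq wv0 => wy; apply/eqP; apply: (proj1 Kgeo _ xK w) => // v.
  rewrite !inE negb_or => /andP[vx vf].
  by have [->//|vy] := eqVneq v y; apply: ws; rewrite !inE !negb_or vx vy.
pose w' v := w v / w x.
have w's v : v \notin x |: (y |: f) -> w' v = 0 by move=> /ws; rewrite /w' => ->; rewrite mul0r.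
have dw' : affine_dep w'.
  split; first by rewrite -mulr_suml w1 mul0r.
  under eq_bigr do rewrite /w' mulrC -scalerA.
  by rewrite -scaler_sumr wp scaler0.
have w'x : w' x = 1 by rewrite /w' divff.
exists w'; split => //.
have : w' y != 0 by rewrite mulf_neq0 ?invr_neq0.
rewrite neq_lt => /orP[neg|//]; exfalso.
by apply: (@apexes_opposite f x y w') => //; rewrite w'x.
Qed.

(** Three apexes cannot lie pairwise on opposite sides: subtracting the dependencies for [x], [y]
    and for [x], [z] removes [x] and leaves opposite signs at [y] and [z]. *)
Lemma triangle_cofaces_le2 (f : {set V}) : f \in simplices K 2 ->
  (#|[set t in simplices K 3 | f \subset t]| <= 2)%N.
Proof.
move=> /simplicesP[fK f3]; rewrite leqNgt; apply/negP => /card_gt2P[t1 [t2 [t3]]].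
have apex t : t \in [set t in simplices K 3 | f \subset t] ->
    exists x, [/\ x \notin f, t = x |: f & x |: f \in K].
  rewrite inE => /andP[/simplicesP[tK t4] ft].
  have /cards1P[x xE] : #|t :\: f| == 1%N by rewrite cardsDS // t4 f3.
  have := set11 x; rewrite -xE inE => /andP[xf xt].
  have tE : t = x |: f by rewrite -xE finset.setUC -{1}(finset.setID t f) (finset.setIidPr ft).
  by exists x; rewrite -tE.
case=> [[/apex[x [xf -> xK]] /apex[y [yf -> yK]] /apex[z [zf -> zK]]] [n12 n23 n31]].
have xy : x != y by apply: contraNneq n12 => ->.
have yz : y != z by apply: contraNneq n23 => ->.
have zx : z != x by apply: contraNneq n31 => ->.
have [w [ws [w1 wp] wx wy]] := apexes_same_sign f3 xf yf xy xK yK.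
have [|u [us [u1 up] ux uz]] := apexes_same_sign f3 xf zf _ xK zK; first by rewrite eq_sym.
apply: (@apexes_opposite f y z (fun v => w v - u v)) => //.
- move=> v; rewrite !inE !negb_or => /and3P[vy vz vf].
  have [->|vx] := eqVneq v x; first by rewrite wx ux subrr.
  by rewrite ws ?us ?subrr // !inE !negb_or vx ?vy ?vz.
- split; first by rewrite sumrB w1 u1 subrr.
  by under eq_bigr do rewrite scalerBl; rewrite sumrB wp up subrr.
- by rewrite us ?subr0 // !inE !negb_or yz yf eq_sym xy.
- by rewrite ws ?sub0r ?oppr_lt0 // !inE !negb_or zx zf eq_sym yz.
Qed.

End TetrahedraAtTriangle.

(** * Comparing collapses with matchings by counting *)

Theorem theorem4 (R : realType) (V : finType) (K : {set {set V}})
  (pos : V -> 'rV[R]_3) (or : {set V} -> bool) :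
  is_simplicial_complex K ->
  complex_dim K 3 ->
  geometric_realization pos K ->
  lipschitz_boundary (polyhedron pos K) ->
  homeomorphic (polyhedron pos K) (@closed_unit_ball R) ->
  collapsible K <->
  exists M : {set {set V} * {set V}},
    [/\ matching1 K M, acyclic1 M & complete1 R K or M].
Proof.
move=> Kcx [[t0 [t0K t04]] K4] Kgeo _ Kball.
have /set0Pn[v0 v0t] : t0 != finset.set0 by rewrite -card_gt0 t04.
have ex m : (0 < m <= 4)%N -> exact_at K m.
  by move=> m4 c; apply: ball_cohomology0 v0 Kcx Kgeo Kball m4.
have v0K : [set v0]%SET \in simplices K 0.
  apply/simplicesP; rewrite cards1; split=> //; apply: (proj2 Kcx t0) => //.
    by rewrite finset.sub1set.
  by apply/set0Pn; exists v0; rewrite finset.set11.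
have n0 : (0 < #|simplices K 0|)%N by apply/card_gt0P; exists [set v0]%SET.
have cK : conn K by apply: exact_conn; apply: ex.
have ge := rank_face_edge_ge K or R.
have lt1 := edges_rank_lt Kcx (ex 2 isT) n0.
have le2 := triangles_rank_le Kcx (ex 3 isT).
have le := rank_face_edge_le or Kcx R cK.
split.
  case=> v /(collapses_matching Kcx)[M [mM aM _ _ cM]]; exists M; split => //.
  rewrite /complete1.
  have s0 : #|simplices [set [set v]]%SET 0| = 1%N.
    rewrite -(cards1 [set v]%SET); apply: eq_card => s; rewrite !inE.
    by case: eqP => // ->; rewrite cards1.
  have s1 : #|simplices [set [set v]]%SET 1| = 0%N.
    apply: eq_card0 => s; rewrite !inE; case: eqP => // ->; by rewrite cards1.
  (* Here [q] and [k] are the mod 2 and the real rank, [a] and [b] the numbers of vertices and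
     edges; the bounds force [k = b + 1 - a], the number of matched pairs. *)
  have arith m a b q k : (m + 0 + a = b + 1 -> q <= k -> b < q + a -> k + a <= b.+1 -> m = k)%N.
    by clear; lia.
  by rewrite s0 s1 in cM; apply: arith cM ge lt1 le.
case=> M [mM aM cM].
have two := triangle_cofaces_le2 Kgeo.
have H3 t : t \in simplices K 3 -> exists b, forall u, u \in simplices K 3 ->
     scobd b u = (u == t)%:R.
  (* No simplex has five vertices, so every function on the tetrahedra is a cocycle, and exactness
     makes it a coboundary. *)
  move=> _; have [u uK u5|b bP] := ex 4%N isT (fun u => (u == t)%:R).
    by have := K4 u uK; rewrite u5.
  by exists b => u /simplicesP[uK u4]; apply: bP.
have [K1 [c1 K1_3 mM1 n2 [sub1 n1 n0']]] := collapse_tetrahedra Kcx K4 mM aM two H3.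
have K1cx := collapses_complex Kcx c1.
have K13 s : s \in K1 -> (#|s| <= 3)%N.
  move=> sK; have := K4 s (fintype.subsetP sub1 s sK); rewrite leq_eqVlt => /orP[/eqP s4|//].
  have : s \in simplices K1 3 by apply/simplicesP.
  by rewrite K1_3 inE.
have inj2 : {in M &, injective snd} by case: mM => _ _ m3 p q; apply: m3.
(* All matched triangles survive in [K1]. Each tetrahedron took one triangle with it, so the rank
   bound leaves at most as many triangles as there are pairs. *)
have K1M : simplices K1 2 = [set p.2 | p in M]%SET.
  apply/esym/eqP; rewrite eqEcard card_in_imset //; apply/andP; split.
    by apply/fintype.subsetP => f /imsetP[p pM ->]; case: mM1 => /(_ p pM)[].
  have arith m a b q k : (k + b = a -> q <= m -> a <= q + b -> k <= m)%N by clear; lia.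
  by rewrite -cM in ge; apply: arith n2 ge le2.
have [K2 [c2 K2_2 sub2 e2 v2]] := collapse_triangles K1cx K13 aM (subxx M) mM1 K1M.
have c12 := collapses_trans c1 c2.
have K2cx := collapses_complex Kcx c12.
have [|||v cv] := collapse_tree K2cx _ (collapses_conn Kcx c12 cK).
- move=> s sK; have := K13 s (fintype.subsetP sub2 s sK); rewrite leq_eqVlt => /orP[/eqP s3|//].
  have : s \in simplices K2 2 by apply/simplicesP.
  by rewrite K2_2 inE.
- by rewrite v2 n0'.
(* Each matched pair removed one edge, so fewer edges than vertices remain. *)
- have arith m a b q k : (k + m = b -> q <= m -> b < q + a -> k < a)%N by clear; lia.
  by rewrite v2 n0'; rewrite -cM in ge; rewrite n1 in e2; apply: arith e2 ge lt1.
by exists v; apply: collapses_trans c12 cv.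
Qed.
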